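(* Let $G=(V,E)$ be a rank-$r$ hypergraph and let $\bar z \in [0,1]^{V+E}$ be a vector (with one component $\bar z_v$ for each $v\in V$ and one component $\bar z_e$ for each $e \in E$). Then the separation problem over all extended flower inequalities of $G$, i.e. the problem of deciding whether $\bar z$ satisfies all extended flower inequalities (centered at all edges of $G$) and, if not, finding an extended flower inequality that is violated by $\bar z$, can be solved in $$O\Big(|E|\big(r2^r|E|+r^2 2^{r^2/2}\big)\Big)$$ operations.
   Context: A hypergraph $G=(V,E)$ consists of a finite set $V$ of nodes and a set $E$ of subsets of $V$ of cardinality at least two, called edges. The rank of $G$ is $r=\max\{|e| : e\in E\}$; ''rank-$r$'' means the rank equals $r$. Throughout, $r\ge 3$ and every node belongs to at least one edge. Two distinct edges are adjacent if they have nonempty intersection. Extended flower inequalities. Let $e_0\in E$ and let $e_k$, $k\in K$, be the set of all edges adjacent to $e_0$. Let $T$ be a nonempty subset of $K$ such that $$\Big|(e_0 \cap e_i)\setminus \bigcup_{j \in T \setminus \{i\}}(e_0 \cap e_j)\Big| \geq 2, \quad \forall i \in T.$$ The extended flower inequality centered at $e_0$ with neighbors $e_k$, $k\in T$, is the following inequality in the variables $z\in\mathbb{R}^{V+E}$: $$\sum_{v \in e_0\setminus \bigcup_{k\in T} e_k} z_v+\sum_{k \in T} z_{e_k} - z_{e_0} \leq \Big|e_0\setminus \bigcup_{k\in T} e_k\Big|+|T|-1.$$ Input representation: the hypergraph is given by an incidence-list in which every edge stores the vertices it contains, and the vertex list of each edge is sorted. *)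

(* Defs.v *)
From HB Require Import structures.
From mathcomp Require Import all_boot all_order all_algebra.
From mathcomp Require Import reals exp.

Set Implicit Arguments.
Unset Strict Implicit.
Unset Printing Implicit Defensive.

Import Order.TTheory GRing.Theory Num.Theory.

Record hypergraph := Hypergraph {
  node : finType;
  edges : {set {set node}};
  edges_card : forall e, e \in edges -> 1 < #|e|
}.

Definition edge (G : hypergraph) : finType :=
  {e : {set node G} | e \in edges G}.

Definition nodes_of (G : hypergraph) (e : edge G) : {set node G} := val e.

Definition rank (G : hypergraph) : nat := \max_(e in edges G) #|e|.

Definition no_isolated_node (G : hypergraph) : Prop :=
  forall v : node G, exists e : edge G, v \in nodes_of e.

Definition adjacent (G : hypergraph) (e f : edge G) : bool :=
  (e != f) && (nodes_of e :&: nodes_of f != set0).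

Definition flower (G : hypergraph) (e0 : edge G) (T : {set edge G}) : Prop :=
  [/\ T != set0,
      forall e, e \in T -> adjacent e0 e
    & forall e, e \in T ->
        2 <= #|(nodes_of e0 :&: nodes_of e)
               :\: \bigcup_(f in T :\ e) (nodes_of e0 :&: nodes_of f)|].

Definition uncovered (G : hypergraph) (e0 : edge G) (T : {set edge G}) :
    {set node G} :=
  nodes_of e0 :\: \bigcup_(e in T) nodes_of e.

Definition flower_ineq (R : realType) (G : hypergraph)
    (z : node G + edge G -> R) (e0 : edge G) (T : {set edge G}) : Prop :=
  (\sum_(v in uncovered e0 T) z (inl v) + \sum_(e in T) z (inr e) - z (inr e0)
     <= #|uncovered e0 T|%:R + #|T|%:R - 1)%R.

(** A real random-access machine: structured programs over a store made of
    natural-number and real scalars and one-dimensional arrays.  A program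
    mentions finitely many names, so the arrays can be interleaved in one
    memory at constant overhead.  Every operator, literal, memory access,
    assignment and test costs one unit.  Naturals only have addition and
    truncated subtraction, because unit-cost multiplication would make large
    integers unrealistically cheap. *)

Inductive nexp : Type :=
| NLit of nat
| NVar of nat
| NGet of nat & nexp
| NAdd of nexp & nexp
| NSub of nexp & nexp.

Inductive rexp : Type :=
| RZero
| ROne
| RVar of nat
| RGet of nat & nexp
| RAdd of rexp & rexp
| RSub of rexp & rexp.

Inductive bexp : Type :=
| NLe of nexp & nexp
| RLe of rexp & rexp
| BNot of bexp
| BAnd of bexp & bexp.

Inductive prog : Type :=
| Skip
| NSet of nat & nexp
| NPut of nat & nexp & nexp
| RSet of nat & rexp
| RPut of nat & nexp & rexp
| Seq of prog & prog
| If of bexp & prog & prog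
| While of bexp & prog.

Record state (R : realType) := State {
  nvar : nat -> nat;
  narr : nat -> nat -> nat;
  rvar : nat -> R;
  rarr : nat -> nat -> R
}.

Definition upd (A : Type) (f : nat -> A) (x : nat) (a : A) : nat -> A :=
  fun y => if y == x then a else f y.

Fixpoint neval (R : realType) (s : state R) (e : nexp) : nat :=
  match e with
  | NLit n => n
  | NVar x => nvar s x
  | NGet a i => narr s a (neval s i)
  | NAdd e1 e2 => neval s e1 + neval s e2
  | NSub e1 e2 => neval s e1 - neval s e2
  end.

Fixpoint reval (R : realType) (s : state R) (e : rexp) : R :=
  match e with
  | RZero => 0%R
  | ROne => 1%R
  | RVar x => rvar s x
  | RGet a i => rarr s a (neval s i)
  | RAdd e1 e2 => (reval s e1 + reval s e2)%R
  | RSub e1 e2 => (reval s e1 - reval s e2)%R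
  end.

Fixpoint beval (R : realType) (s : state R) (b : bexp) : bool :=
  match b with
  | NLe e1 e2 => neval s e1 <= neval s e2
  | RLe e1 e2 => (reval s e1 <= reval s e2)%R
  | BNot b1 => ~~ beval s b1
  | BAnd b1 b2 => beval s b1 && beval s b2
  end.

Fixpoint ncost (e : nexp) : nat :=
  match e with
  | NLit _ | NVar _ => 1
  | NGet _ i => (ncost i).+1
  | NAdd e1 e2 | NSub e1 e2 => (ncost e1 + ncost e2).+1
  end.

Fixpoint rcost (e : rexp) : nat :=
  match e with
  | RZero | ROne | RVar _ => 1
  | RGet _ i => (ncost i).+1
  | RAdd e1 e2 | RSub e1 e2 => (rcost e1 + rcost e2).+1
  end.

Fixpoint bcost (b : bexp) : nat :=
  match b with
  | NLe e1 e2 => (ncost e1 + ncost e2).+1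
  | RLe e1 e2 => (rcost e1 + rcost e2).+1
  | BNot b1 => (bcost b1).+1
  | BAnd b1 b2 => (bcost b1 + bcost b2).+1
  end.

Definition set_nvar (R : realType) (s : state R) (x n : nat) : state R :=
  State (upd (nvar s) x n) (narr s) (rvar s) (rarr s).

Definition set_narr (R : realType) (s : state R) (a i n : nat) : state R :=
  State (nvar s) (upd (narr s) a (upd (narr s a) i n)) (rvar s) (rarr s).

Definition set_rvar (R : realType) (s : state R) (x : nat) (t : R) : state R :=
  State (nvar s) (narr s) (upd (rvar s) x t) (rarr s).

Definition set_rarr (R : realType) (s : state R) (a i : nat) (t : R) :
    state R :=
  State (nvar s) (narr s) (rvar s) (upd (rarr s) a (upd (rarr s a) i t)).

(* [exec p s s' k]: started in [s], [p] halts in [s'] after [k] operations. *)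
Inductive exec (R : realType) : prog -> state R -> state R -> nat -> Prop :=
| ExecSkip s : exec Skip s s 1
| ExecNSet s x e : exec (NSet x e) s (set_nvar s x (neval s e)) (ncost e).+1
| ExecNPut s a i e :
    exec (NPut a i e) s (set_narr s a (neval s i) (neval s e))
      (ncost i + ncost e).+1
| ExecRSet s x e : exec (RSet x e) s (set_rvar s x (reval s e)) (rcost e).+1
| ExecRPut s a i e :
    exec (RPut a i e) s (set_rarr s a (neval s i) (reval s e))
      (ncost i + rcost e).+1
| ExecSeq s1 s2 s3 p q k l :
    exec p s1 s2 k -> exec q s2 s3 l -> exec (Seq p q) s1 s3 (k + l)
| ExecIfTrue s s' b p q k :
    beval s b -> exec p s s' k -> exec (If b p q) s s' (bcost b + k).+1
| ExecIfFalse s s' b p q k :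
    ~~ beval s b -> exec q s s' k -> exec (If b p q) s s' (bcost b + k).+1
| ExecWhileFalse s b p :
    ~~ beval s b -> exec (While b p) s s (bcost b).+1
| ExecWhileTrue s1 s2 s3 b p k l :
    beval s1 b -> exec p s1 s2 k -> exec (While b p) s2 s3 l ->
    exec (While b p) s1 s3 (bcost b + k + l).+1.

Lemma exec_det (R : realType) (p : prog) (s s1 s2 : state R) (k1 k2 : nat) :
  exec p s s1 k1 -> exec p s s2 k2 -> s1 = s2 /\ k1 = k2.
Proof.
move=> H; elim: H s2 k2 => {p s s1 k1} [s|s x e|s a i e|s x e|s a i e
    |s1 s2 s3 p q k l _ IHp _ IHq|s s' b p q k Hb _ IH|s s' b p q k Hb _ IH
    |s b p Hb|s1 s2 s3 b p k l Hb _ IHp _ IHw] s4 k4 H;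
  inversion H; subst => //;
  repeat match goal with
  | Hb : is_true (beval ?s ?b), Hn : is_true (~~ beval ?s ?b) |- _ =>
      by rewrite Hb in Hn
  | IH : forall t m, exec ?p ?s t m -> _, E : exec ?p ?s _ _ |- _ =>
      case: (IH _ _ E) => ? ?; subst; clear E
  end; done.
Qed.

(* An arbitrary numbering of the nodes and of the edges: an item's number is
   its index in the list. *)
Record numbering (G : hypergraph) := Numbering {
  node_list : seq (node G);
  edge_list : seq (edge G);
  node_listP : perm_eq node_list (enum (node G));
  edge_listP : perm_eq edge_list (enum (edge G))
}.

Definition node_num (G : hypergraph) (L : numbering G) (v : node G) : nat :=
  index v (node_list L).

Definition edge_num (G : hypergraph) (L : numbering G) (e : edge G) : nat :=
  index e (edge_list L).

Definition vertex_list (G : hypergraph) (L : numbering G) (e : edge G) :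
    seq nat :=
  sort leq [seq node_num L v | v in nodes_of e].

(* The vertex lists are stored consecutively in natural-number array 1; that
   of edge number [k] occupies the positions from [start k] up to, excluding,
   [start k.+1], where [start] is natural-number array 0. *)
Definition start (G : hypergraph) (L : numbering G) (k : nat) : nat :=
  sumn [seq size (vertex_list L e) | e <- take k (edge_list L)].

Definition input (R : realType) (G : hypergraph) (L : numbering G)
    (z : node G + edge G -> R) : state R :=
  {| nvar x :=
       match x with
       | 0 => #|node G|
       | 1 => #|edge G|
       | _ => 0
       end;
     narr a i :=
       match a with
       | 0 => start L i
       | 1 => nth 0 (flatten [seq vertex_list L e | e <- edge_list L]) i
       | _ => 0
       end;
     rvar _ := 0%R;
     rarr a i :=
       match a with
       | 0 => nth 0%R [seq z (inl v) | v <- node_list L] i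
       | 1 => nth 0%R [seq z (inr e) | e <- edge_list L] i
       | _ => 0%R
       end |}.

(* Scalar 0 is the verdict: 0 claims that all inequalities hold, anything
   else that the one described by scalar 1 (number of the center), scalar 2
   (number of neighbors) and array 0 (numbers of the neighbors) is
   violated. *)
Definition correct_output (R : realType) (G : hypergraph) (L : numbering G)
    (z : node G + edge G -> R) (s : state R) : Prop :=
  if nvar s 0 == 0 then
    forall (e0 : edge G) (T : {set edge G}), flower e0 T -> flower_ineq z e0 T
  else
    exists (e0 : edge G) (T : {set edge G}),
      [/\ nvar s 1 = edge_num L e0,
          perm_eq (mkseq (narr s 0) (nvar s 2)) [seq edge_num L e | e in T],
          flower e0 T
        & ~ flower_ineq z e0 T].

Definition separation_bound (R : realType) (m r : nat) : R :=
  (m%:R * (r%:R * 2 ^+ r * m%:R + r%:R ^+ 2 * 2 `^ (r%:R ^+ 2 / 2)))%R.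

(* Main.v *)
Require Import Defs.
From mathcomp Require Import all_boot all_order all_algebra.
From mathcomp Require Import reals exp.
From mathcomp Require Import zify lra.

(** Fix a center [e0] with [n] nodes.  Subtracting from the number of summands,
    the flower inequality of neighbors [T] is violated exactly when

      sum_(e in T) (1 - z e) + sum_(v uncovered) (1 - z v) < 1 - z e0

    ([flower_ineqE]).  The flower conditions and the uncovered nodes depend
    only on the traces of the neighbors on [e0], so among the edges with a
    given trace only one with the largest value matters.  Moreover the sets of
    nodes owned by a single neighbor are disjoint and have at least two
    elements, so [T] has at most [n./2] members ([flower_card]).

    For each center the program therefore works in two phases.  It first
    tabulates, for each of the [2 ^ n] possible traces, an edge of largest
    value with this trace; the traces are computed by comparing all pairs of
    nodes, which takes [O(r ^ 2)] operations per edge, hence [O(r 2 ^ r |E|)]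
    for all edges ([runs_table]).  Then it enumerates all 0-1 matrices with
    [n./2] rows and [n] columns by incrementing a binary counter: the nonzero
    rows are the traces of a family of neighbors.  There are at most
    [2 ^ (r ^ 2 / 2)] matrices, and in [O(r ^ 2)] operations one checks that
    each nonzero row is the trace of a tabulated edge owning two columns or more,
    and compares the weight of the family with [1 - z e0] ([runs_check],
    [runs_search]).

    A matrix that passes the test yields a violated inequality
    ([violating_sound]): two nonzero rows that own a column are different, so
    the tabulated edges are pairwise distinct.  Conversely, if [T] is violated
    then the matrix listing the traces of the members of [T] passes the test
    ([violating_complete]), because replacing members of [T] by tabulated
    edges with the same traces cannot increase the weight.

    Programs are verified with a total-correctness judgment [runs] that also
    bounds the number of operations; what a program leaves untouched is read
    off its text ([exec_frame]). *)

Set Implicit Arguments.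
Unset Strict Implicit.
Unset Printing Implicit Defensive.

Import Order.TTheory GRing.Theory Num.Theory.

Local Arguments iota : simpl never.
Local Arguments has : simpl never.

(** * Costed total correctness for machine programs *)

(** The scalars and arrays that a program may write. *)
Fixpoint nwrites (p : prog) : seq nat :=
  match p with
  | NSet x _ => [:: x]
  | Seq p q | If _ p q => nwrites p ++ nwrites q
  | While _ p => nwrites p
  | _ => [::]
  end.

Fixpoint awrites (p : prog) : seq nat :=
  match p with
  | NPut a _ _ => [:: a]
  | Seq p q | If _ p q => awrites p ++ awrites q
  | While _ p => awrites p
  | _ => [::]
  end.

Fixpoint rwrites (p : prog) : seq nat :=
  match p with
  | RSet x _ => [:: x]
  | Seq p q | If _ p q => rwrites p ++ rwrites q
  | While _ p => rwrites p
  | _ => [::]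
  end.

Fixpoint rawrites (p : prog) : seq nat :=
  match p with
  | RPut a _ _ => [:: a]
  | Seq p q | If _ p q => rawrites p ++ rawrites q
  | While _ p => rawrites p
  | _ => [::]
  end.

(** [frame p s s']: the stores differ only where [p] may write. *)
Record frame (R : realType) (p : prog) (s s' : state R) : Prop := Frame {
  frameN : forall x, x \notin nwrites p -> nvar s' x = nvar s x;
  frameA : forall a, a \notin awrites p -> narr s' a = narr s a;
  frameR : forall x, x \notin rwrites p -> rvar s' x = rvar s x;
  frameRA : forall a, a \notin rawrites p -> rarr s' a = rarr s a
}.

Lemma updE (A : Type) (f : nat -> A) x a : upd f x a x = a.
Proof. by rewrite /upd eqxx. Qed.

Lemma updN (A : Type) (f : nat -> A) x a y : y != x -> upd f x a y = f y.
Proof. by rewrite /upd => /negPf ->. Qed.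

Lemma exec_frame (R : realType) p (s s' : state R) k :
  exec p s s' k -> frame p s s'.
Proof.
have catl (q r : seq nat) x : x \notin q ++ r -> x \notin q.
  by rewrite mem_cat negb_or => /andP[].
have catr (q r : seq nat) x : x \notin q ++ r -> x \notin r.
  by rewrite mem_cat negb_or => /andP[].
elim=> {p s s' k} [s|s x e|s a i e|s x e|s a i e
    |s1 s2 s3 p q k l _ [n1 a1 r1 ra1] _ [n2 a2 r2 ra2]
    |s s' b p q k Hb _ [n1 a1 r1 ra1]|s s' b p q k Hb _ [n1 a1 r1 ra1]
    |s b p Hb|s1 s2 s3 b p k l Hb _ [n1 a1 r1 ra1] _ [n2 a2 r2 ra2]].
all: split=> //= y yn.
all: try by rewrite updN // -mem_seq1.
all: try by rewrite ?(n1, a1, r1, ra1) ?(catl _ _ _ yn) ?(catr _ _ _ yn).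
all: by rewrite ?(n2, a2, r2, ra2) ?(n1, a1, r1, ra1) ?(catl _ _ _ yn)
  ?(catr _ _ _ yn).
Qed.

(** Total correctness with a cost: started in [s], the program [p] halts within
    [c] operations in a state satisfying [Q]. *)
Definition runs (R : realType) (p : prog) (s : state R) (c : nat)
    (Q : state R -> Prop) : Prop :=
  exists s' k, [/\ exec p s s' k, k <= c & Q s'].

Lemma runs_seq (R : realType) p q (s : state R) c1 c2 c P Q :
  runs p s c1 P ->
  (forall s1, frame p s s1 -> P s1 -> runs q s1 c2 Q) ->
  c1 + c2 <= c -> runs (Seq p q) s c Q.
Proof.
move=> [s1 [k [Ep kc Ps]]] H lec.
have [s2 [l [Eq lc Qs]]] := H s1 (exec_frame Ep) Ps.
exists s2, (k + l); split=> //; first exact: ExecSeq Ep Eq.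
by apply: leq_trans lec; apply: leq_add.
Qed.

Lemma runs_if (R : realType) b p q (s : state R) c c' Q :
  (beval s b -> runs p s c Q) -> (~~ beval s b -> runs q s c Q) ->
  bcost b + c < c' -> runs (If b p q) s c' Q.
Proof.
move=> Hp Hq lec; case: (boolP (beval s b)) => Hb.
  have [s' [k [E kc Qs]]] := Hp Hb; exists s', (bcost b + k).+1.
  by split=> //; [exact: ExecIfTrue|lia].
have [s' [k [E kc Qs]]] := Hq Hb; exists s', (bcost b + k).+1.
by split=> //; [exact: ExecIfFalse|lia].
Qed.

Lemma runs_weaken (R : realType) p (s : state R) c c' (P Q : state R -> Prop) :
  runs p s c P -> (forall s', frame p s s' -> P s' -> Q s') -> c <= c' ->
  runs p s c' Q.
Proof.
move=> [s' [k [E kc Ps]]] PQ le_c; exists s', k; split=> //.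
  exact: leq_trans le_c.
by apply: PQ => //; apply: exec_frame E.
Qed.

Fixpoint loopfree (p : prog) : bool :=
  match p with
  | Seq p q | If _ p q => loopfree p && loopfree q
  | While _ _ => false
  | _ => true
  end.

(** The final state and a cost bound of a loop-free program; the values on loops
    are irrelevant. *)
Fixpoint effect (R : realType) (p : prog) (s : state R) : state R :=
  match p with
  | Skip | While _ _ => s
  | NSet x e => set_nvar s x (neval s e)
  | NPut a i e => set_narr s a (neval s i) (neval s e)
  | RSet x e => set_rvar s x (reval s e)
  | RPut a i e => set_rarr s a (neval s i) (reval s e)
  | Seq p q => effect q (effect p s)
  | If b p q => if beval s b then effect p s else effect q s
  end.

Fixpoint cost (p : prog) : nat :=
  match p with
  | Skip | While _ _ => 1
  | NSet x e => (ncost e).+1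
  | NPut a i e => (ncost i + ncost e).+1
  | RSet x e => (rcost e).+1
  | RPut a i e => (ncost i + rcost e).+1
  | Seq p q => cost p + cost q
  | If b p q => (bcost b + maxn (cost p) (cost q)).+1
  end.

Lemma runs_effect (R : realType) p (s : state R) :
  loopfree p -> runs p s (cost p) (fun s' => s' = effect p s).
Proof.
elim: p s => //=.
- by move=> s _; exists s, 1; split=> //; constructor.
- by move=> x e s _; exists (set_nvar s x (neval s e)), (ncost e).+1;
    split=> //; constructor.
- by move=> a i e s _; eexists _, _; split; last reflexivity;
    first by constructor.
- by move=> x e s _; eexists _, _; split; last reflexivity;
    first by constructor.
- by move=> a i e s _; eexists _, _; split; last reflexivity;
    first by constructor.
- move=> p IHp q IHq s /andP[lp lq].
  by apply: (runs_seq (IHp s lp)) => [s1 _ ->|]; first exact: IHq.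
- move=> b p IHp q IHq s /andP[lp lq].
  apply: (runs_if (c := maxn (cost p) (cost q))) => [Hb|/negPf Hb|].
  + rewrite Hb; apply: (runs_weaken (IHp s lp)) => //; exact: leq_maxl.
  + rewrite Hb; apply: (runs_weaken (IHq s lq)) => //; exact: leq_maxr.
  + by [].
Qed.

Lemma runs_effectQ (R : realType) p (s : state R) c (Q : state R -> Prop) :
  loopfree p -> Q (effect p s) -> cost p <= c -> runs p s c Q.
Proof.
by move=> lp Qs le_c; apply: (runs_weaken (runs_effect s lp)) le_c => s' _ ->.
Qed.

Lemma runs_block (R : realType) p q (s : state R) c c' (Q : state R -> Prop) :
  loopfree p -> runs q (effect p s) c Q -> cost p + c <= c' ->
  runs (Seq p q) s c' Q.
Proof.
by move=> lp Hq; apply: runs_seq (runs_effect s lp) _ => s1 _ ->.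
Qed.

(** Runs [p] for [i] from 0 up to, excluding, the value of scalar [b]. *)
Definition for_ (i b : nat) (p : prog) : prog :=
  Seq (NSet i (NLit 0))
    (While (NLe (NAdd (NVar i) (NLit 1)) (NVar b))
       (Seq p (NSet i (NAdd (NVar i) (NLit 1))))).

(** The invariant [I j] holds on entry to the iteration in which the counter is
    [j]; [frame] relates every iteration to the state before the loop, so the
    invariant need only speak of what the body writes. *)
Lemma runs_for (R : realType) i b p (s : state R) n c c'
    (I : nat -> state R -> Prop) :
  i != b -> i \notin nwrites p -> b \notin nwrites p -> nvar s b = n ->
  I 0 (set_nvar s i 0) ->
  (forall j s1, j < n -> nvar s1 i = j -> frame (for_ i b p) s s1 -> I j s1 ->
     runs p s1 c (fun s2 => I j.+1 (set_nvar s2 i j.+1))) ->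
  8 + n * (c + 10) <= c' -> runs (for_ i b p) s c' (I n).
Proof.
move=> ib ip bp sb I0 IS le_c.
suff H d s1 j : d + j = n -> nvar s1 i = j -> frame (for_ i b p) s s1 ->
    I j s1 ->
    runs (While (NLe (NAdd (NVar i) (NLit 1)) (NVar b))
       (Seq p (NSet i (NAdd (NVar i) (NLit 1))))) s1 (6 + d * (c + 10)) (I n).
  have E : exec (NSet i (NLit 0)) s (set_nvar s i 0) 2 by exact: ExecNSet.
  have F : frame (for_ i b p) s (set_nvar s i 0).
    by split=> //= x; rewrite inE negb_or => /andP[xi _]; rewrite updN.
  have [s' [k [E' kc Is]]] :=
    H n (set_nvar s i 0) 0 (addn0 n) (updE _ _ _) F I0.
  exists s', (2 + k); split=> //; first exact: ExecSeq E E'.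
  exact: leq_trans le_c.
elim: d s1 j => [|d IHd] s1 j.
  rewrite add0n => -> s1i F Ij; exists s1, 6; split=> //.
  apply: ExecWhileFalse => /=; rewrite s1i (frameN F) ?sb; first lia.
  by rewrite /= inE negb_or mem_cat negb_or bp inE eq_sym ib.
move=> djn s1i F Ij.
have jn : j < n by lia.
have [s2 [k [E kc I2]]] := IS j s1 jn s1i F Ij.
have s2i : nvar s2 i = j by rewrite (frameN (exec_frame E)).
set s3 := set_nvar s2 i j.+1.
have E3 : exec (Seq p (NSet i (NAdd (NVar i) (NLit 1)))) s1 s3 (k + 4).
  apply: ExecSeq E _.
  have := ExecNSet s2 i (NAdd (NVar i) (NLit 1)).
  by rewrite /= s2i addn1.
have F3 : frame (for_ i b p) s s3.
  case: F (exec_frame E3) => [A B C D] [A' B' C' D'].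
  have sub x : x \notin nwrites (for_ i b p) ->
      x \notin nwrites (Seq p (NSet i (NAdd (NVar i) (NLit 1)))).
    by rewrite /= inE negb_or => /andP[].
  by split=> x xp; rewrite ?A' ?B' ?C' ?D' //; auto.
have djn' : d + j.+1 = n by rewrite addnS.
have [s' [l [E4 lc I4]]] := IHd s3 j.+1 djn' (updE _ _ _) F3 I2.
exists s', (5 + (k + 4) + l).+1; split=> //; last lia.
apply: ExecWhileTrue E3 E4 => /=.
rewrite s1i (frameN F) ?sb; first lia.
by rewrite /= inE negb_or mem_cat negb_or bp inE eq_sym ib.
Qed.

Definition incr (x : nat) : prog := NSet x (NAdd (NVar x) (NLit 1)).

(** [pow2 x i b] sets [x] to the power of two with exponent [b]. *)
Definition pow2 (x i b : nat) : prog :=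
  Seq (NSet x (NLit 1)) (for_ i b (NSet x (NAdd (NVar x) (NVar x)))).

(** [clear a i b] zeroes the first [b] cells of array [a]. *)
Definition clear (a i b : nat) : prog := for_ i b (NPut a (NVar i) (NLit 0)).

Lemma runs_pow2 (R : realType) (s : state R) x i b n :
  i != b -> i != x -> b != x -> nvar s b = n ->
  runs (pow2 x i b) s (10 + n * 14) (fun s' => nvar s' x = 2 ^ n).
Proof.
move=> ib ix bx sb.
apply: (runs_block (c := 8 + n * 14)) => //.
  apply: (runs_for (n := n) (c := 4)
    (I := fun j s' => nvar s' x = 2 ^ j)) => //=.
  - by rewrite mem_seq1.
  - by rewrite mem_seq1.
  - by rewrite updN.
  - by rewrite updN ?updE // eq_sym.
  move=> j s2 jn sj F sx; apply: runs_effectQ => //=.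
  by rewrite updN 1?eq_sym // updE sx expnS mul2n addnn.
Qed.

Lemma runs_clear (R : realType) (s : state R) a i b n :
  i != b -> nvar s b = n ->
  runs (clear a i b) s (8 + n * 13)
    (fun s' => forall x, x < n -> narr s' a x = 0).
Proof.
move=> ib sb.
apply: (runs_for (n := n) (c := 3)
  (I := fun j s' => forall x, x < j -> narr s' a x = 0)) => //=.
move=> j s2 jn sj F sx; apply: runs_effectQ => //= x xj.
by rewrite updE sj /upd; case: eqP => // /eqP xj'; apply: sx; lia.
Qed.

(** * Memory layout *)

Local Arguments upd A f x a y /.

(* Natural-number scalars: number of edges, number of the center. *)
Local Notation vM := 1 (only parsing).
Local Notation vK := 3 (only parsing).
(* Start of the center's vertex list, its length [n], and [2 ^ n]. *)
Local Notation vA := 4 (only parsing).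
Local Notation vN := 5 (only parsing).
Local Notation vP := 6 (only parsing).
(* Current edge, start and length of its vertex list. *)
Local Notation vF := 7 (only parsing).
Local Notation vFs := 8 (only parsing).
Local Notation vFl := 9 (only parsing).
(* Loop counters: columns, vertex lists, matrices, rows or array cells. *)
Local Notation vJ := 10 (only parsing).
Local Notation vL := 11 (only parsing).
Local Notation vT := 18 (only parsing).
Local Notation vI := 19 (only parsing).
(* Node looked for, whether it was found, binary code of a trace. *)
Local Notation vU := 12 (only parsing).
Local Notation vBit := 13 (only parsing).
Local Notation vMask := 14 (only parsing).
(* Number [q] of rows, number [q * n] of bits, number [2 ^ (q * n)] of
   matrices, current bit, carry of the binary counter. *)
Local Notation vQ := 15 (only parsing).
Local Notation vW := 16 (only parsing).
Local Notation vC := 17 (only parsing).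
Local Notation vPos := 20 (only parsing).
Local Notation vCarry := 26 (only parsing).
(* Columns owned by the current row, number of neighbors, whether all rows are
   acceptable; verdict and center of the solution. *)
Local Notation vPriv := 21 (only parsing).
Local Notation vCnt := 22 (only parsing).
Local Notation vOk := 23 (only parsing).
Local Notation vFound := 24 (only parsing).
Local Notation vCenter := 25 (only parsing).
(* Arrays: tabulated edges, bits of the matrix, number of ones in each column,
   numbers of the neighbors.  The real scalar is the weight of the family. *)
Local Notation aBest := 2 (only parsing).
Local Notation aBits := 3 (only parsing).
Local Notation aCov := 4 (only parsing).
Local Notation aOut := 5 (only parsing).
Local Notation wTot := 0 (only parsing).

(** * Tabulating an edge of largest value for each trace *)

(** The number with binary digits [g 0], ..., [g n.-1], most significant digit
    first; it codes the trace of an edge on the center. *)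
Fixpoint num (g : nat -> bool) (n : nat) : nat :=
  if n is n'.+1 then (num g n').*2 + g n' else 0.

Lemma num_lt g n : num g n < 2 ^ n.
Proof. by elim: n => //= n IH; rewrite expnS; case: (g n); lia. Qed.

Lemma num_inj g h n : num g n = num h n -> forall j, j < n -> g j = h j.
Proof.
elim: n => //= n IH E j; rewrite ltnS leq_eqVlt => /predU1P[->|jn].
  by move: E; case: (g n); case: (h n) => //=; lia.
by apply: IH => //; move: E; case: (g n); case: (h n) => /=; lia.
Qed.

Lemma eq_num g h n : (forall j, j < n -> g j = h j) -> num g n = num h n.
Proof.
by elim: n => //= n IH E; rewrite E // IH // => j jn; apply: E; lia.
Qed.

Lemma iota0S n : iota 0 n.+1 = iota 0 n ++ [:: n].
Proof. by rewrite -addn1 iotaD. Qed.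

Lemma num_eq0 g n : (num g n == 0) = ~~ has g (iota 0 n).
Proof.
elim: n => // n IH; rewrite iota0S has_cat negb_or -IH has_seq1 /=.
by case: (g n); lia.
Qed.

(** Sets [vBit] if node number [vU] occurs in the vertex list of the current
    edge. *)
Definition mem_prog : prog :=
  for_ vL vFl
    (If (BAnd (NLe (NGet 1 (NAdd (NVar vFs) (NVar vL))) (NVar vU))
              (NLe (NVar vU) (NGet 1 (NAdd (NVar vFs) (NVar vL)))))
        (NSet vBit (NLit 1)) Skip).

Lemma runs_mem (R : realType) (s : state R) fl :
  nvar s vFl = fl -> nvar s vBit = 0 ->
  runs mem_prog s (8 + fl * 26)
    (fun s' => nvar s' vBit =
       has (fun x => narr s 1 (nvar s vFs + x) == nvar s vU) (iota 0 fl)).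
Proof.
move=> sfl sb.
apply: (runs_for (n := fl) (c := 16) (I := fun j s' => nvar s' vBit =
   has (fun x => narr s 1 (nvar s vFs + x) == nvar s vU) (iota 0 j))) => //=.
move=> j s1 jn sj F sx; apply: runs_effectQ => //=.
rewrite iota0S has_cat has_seq1 sj.
rewrite (frameN F (x := vFs)) // (frameN F (x := vU)) // (frameA F) //.
rewrite -eqn_leq; case: eqP => _; rewrite ?orbF ?orbT //.
Qed.

(** The code of the trace of the current edge on the center. *)
Definition mask_prog : prog :=
  Seq (NSet vMask (NLit 0))
    (for_ vJ vN
       (Seq (Seq (NSet vU (NGet 1 (NAdd (NVar vA) (NVar vJ))))
                 (NSet vBit (NLit 0)))
          (Seq mem_prog
             (NSet vMask
                (NAdd (NAdd (NVar vMask) (NVar vMask)) (NVar vBit)))))).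

(** The code computed by [mask_prog] when the current edge's list has start [fs]
    and length [fl]. *)
Definition mask_of (R : realType) (s : state R) (fs fl : nat) : nat :=
  num (fun j => has (fun x => narr s 1 (fs + x) == narr s 1 (nvar s vA + j))
                    (iota 0 fl)) (nvar s vN).

Lemma runs_mask (R : realType) (s : state R) fl n :
  nvar s vFl = fl -> nvar s vN = n ->
  runs mask_prog s (10 + n * (31 + fl * 26))
    (fun s' => nvar s' vMask = mask_of s (nvar s vFs) fl).
Proof.
move=> sfl sn; rewrite /mask_of sn.
set g := (X in num X _).
apply: (runs_block (c := 8 + n * (31 + fl * 26))) => //.
  apply: (runs_for (n := n) (c := 21 + fl * 26) (I := fun j s' =>
     nvar s' vMask = num g j)) => //=.
  move=> j s2 jn sj F sx.
  apply: (runs_block (c := 14 + fl * 26)) => //.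
  apply: (@runs_seq R _ _ _ (8 + fl * 26) 6 _ (fun s' => nvar s' vBit = g j)).
  - apply: (runs_weaken (runs_mem (fl := fl) _ _)) => //=.
      by rewrite /upd /= (frameN F).
    move=> s' _ ->; rewrite /upd /=.
    by rewrite (frameN F (x := vFs)) // (frameN F (x := vA)) // sj (frameA F).
  - move=> s' F' Hb; apply: runs_effectQ => //=.
    by rewrite /upd /= Hb (frameN F') //= /upd /= sx addnn.
  - lia.
lia.
Qed.

(** Table entries are edge numbers plus one, with 0 for a missing edge. *)
Definition record_prog : prog :=
  If (NLe (NGet aBest (NVar vMask)) (NLit 0))
     (NPut aBest (NVar vMask) (NAdd (NVar vF) (NLit 1)))
     (If (RLe (RGet 1 (NSub (NGet aBest (NVar vMask)) (NLit 1)))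
              (RGet 1 (NVar vF)))
         (NPut aBest (NVar vMask) (NAdd (NVar vF) (NLit 1))) Skip).

Definition edge_prog : prog :=
  If (BNot (BAnd (NLe (NVar vF) (NVar vK)) (NLe (NVar vK) (NVar vF))))
     (Seq (Seq (NSet vFs (NGet 0 (NVar vF)))
               (NSet vFl (NSub (NGet 0 (NAdd (NVar vF) (NLit 1)))
                               (NVar vFs))))
          (Seq mask_prog record_prog))
     Skip.

(** Tabulates, for each trace on edge number [vK], an edge of largest value. *)
Definition table_prog : prog :=
  Seq (Seq (NSet vA (NGet 0 (NVar vK)))
           (NSet vN (NSub (NGet 0 (NAdd (NVar vK) (NLit 1))) (NVar vA))))
  (Seq (pow2 vP vJ vN) (Seq (clear aBest vI vP) (for_ vF vM edge_prog))).

(** [best] tabulates the edges with number below [m] other than [k0]: for each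
    trace code [S < N], an edge of largest value with this code, if any.
    Entries are edge numbers plus one. *)
Definition best_table (R : realType) (zE : nat -> R) (k0 : nat)
    (msk : nat -> nat) (N m : nat) (best : nat -> nat) : Prop :=
  forall S, S < N ->
    (forall f, f < m -> f != k0 -> msk f = S ->
       0 < best S /\ (zE f <= zE (best S).-1)%R) /\
    (0 < best S ->
       [/\ (best S).-1 < m, (best S).-1 != k0 & msk (best S).-1 = S]).

(** The code of the trace of edge number [f] on edge number [k0], as a function
    of the incidence list, with offsets [st] and contents [v]. *)
Definition mask_at (st v : nat -> nat) (k0 f : nat) : nat :=
  num (fun j => has (fun x => v (st f + x) == v (st k0 + j))
                    (iota 0 (st f.+1 - st f))) (st k0.+1 - st k0).

Lemma best_table_replace (R : realType) (zE : nat -> R) k0 msk N m best :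
  best_table zE k0 msk N m best -> m != k0 ->
  best (msk m) = 0 \/ (zE (best (msk m)).-1 <= zE m)%R ->
  best_table zE k0 msk N m.+1 (upd best (msk m) m.+1).
Proof.
move=> H mk H0 S SN; have [Ha Hb] := H S SN.
case: (eqVneq S (msk m)) => [Sm|/negPf Sm]; rewrite /= Sm ?eqxx.
  split=> //= f; rewrite ltnS leq_eqVlt => /predU1P[-> //|fm fk fS].
  split=> //; have [b0 zf] := Ha f fm fk (etrans fS (esym Sm)).
  case: H0 => [E|zz]; first by rewrite Sm E in b0.
  by apply: le_trans zf _; rewrite Sm.
split=> [f|b0]; last by have [? ? ?] := Hb b0; split=> //; lia.
rewrite ltnS leq_eqVlt => /predU1P[->|]; last exact: Ha.
by move=> _ E; rewrite E eqxx in Sm.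
Qed.

Lemma best_table_keep (R : realType) (zE : nat -> R) k0 msk N m best :
  best_table zE k0 msk N m best ->
  (m != k0 -> 0 < best (msk m) /\ (zE m <= zE (best (msk m)).-1)%R) ->
  best_table zE k0 msk N m.+1 best.
Proof.
move=> H H0 S SN; have [Ha Hb] := H S SN.
split=> [f|b0]; last by have [? ? ?] := Hb b0; split=> //; lia.
by rewrite ltnS leq_eqVlt => /predU1P[-> mk <-|]; [apply: H0|apply: Ha].
Qed.

Lemma runs_record (R : realType) (s : state R) zE k0 msk N :
  rarr s 1 = zE -> nvar s vMask = msk (nvar s vF) -> nvar s vF != k0 ->
  best_table zE k0 msk N (nvar s vF) (narr s aBest) ->
  runs record_prog s 22
    (fun s' => best_table zE k0 msk N (nvar s vF).+1 (narr s' aBest)).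
Proof.
move=> sz sm sk H; apply: runs_effectQ => //=.
rewrite sz sm addn1 subn1.
case: ifP => [|/negbT] b0.
  by apply: best_table_replace H sk _; left; lia.
case: ifP => [z1|/negbT z1] /=.
  by apply: best_table_replace H sk _; right.
apply: best_table_keep H _ => _; split; first lia.
by move: z1; rewrite -ltNge => /ltW.
Qed.

(** Since [r <= 2 ^ r], the cost is [O(m r 2 ^ r)] when [m > 0]. *)
Lemma runs_table (R : realType) (s : state R) m r :
  nvar s vM = m -> 0 < r ->
  (forall f, f < m -> narr s 0 f.+1 - narr s 0 f <= r) ->
  nvar s vK < m ->
  runs table_prog s (100 + 27 * 2 ^ r + m * (200 * r ^ 2))
    (fun s' => [/\ nvar s' vA = narr s 0 (nvar s vK),
       nvar s' vN = narr s 0 (nvar s vK).+1 - narr s 0 (nvar s vK) &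
       best_table (rarr s 1) (nvar s vK)
         (mask_at (narr s 0) (narr s 1) (nvar s vK))
         (2 ^ (narr s 0 (nvar s vK).+1 - narr s 0 (nvar s vK))) m
         (narr s' aBest)]).
Proof.
move=> sm r0 len_r km.
set k0 := nvar s vK; set A := narr s 0 k0; set n := _ - A.
have nr : n <= r := len_r _ km.
have n2 : 2 ^ n <= 2 ^ r by rewrite leq_exp2l.
have nn : n <= 2 ^ n by apply: ltnW; apply: ltn_expl.
have r2 : m * (1 + r) <= m * (2 * r ^ 2) by rewrite leq_mul2l; nia.
apply: (runs_block (c := 80 + 27 * 2 ^ r + m * (200 * r ^ 2))) => //;
  last by rewrite /=; lia.
have -> : effect (Seq (NSet vA (NGet 0 (NVar vK)))
           (NSet vN (NSub (NGet 0 (NAdd (NVar vK) (NLit 1))) (NVar vA)))) s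
  = set_nvar (set_nvar s vA A) vN n.
  by rewrite /= addn1.
set s1 := set_nvar _ vN n.
apply: (runs_seq (runs_pow2 (n := n) _ _ _ _)
  (c2 := 60 + 13 * 2 ^ r + m * (200 * r ^ 2))) => //; last by lia.
move=> s2 F2 s2P.
apply: (runs_seq (runs_clear (n := 2 ^ n) _ _ _)
  (c2 := 40 + m * (200 * r ^ 2))) => //; last by lia.
move=> s3 F3 s3b.
have s3A : nvar s3 vA = A by rewrite (frameN F3) // (frameN F2).
have s3N : nvar s3 vN = n by rewrite (frameN F3) // (frameN F2).
set msk := mask_at (narr s 0) (narr s 1) k0.
apply: (@runs_weaken _ _ _ (40 + m * (200 * r ^ 2)) _ (fun s' =>
  best_table (rarr s 1) k0 msk (2 ^ n) m (narr s' aBest))) => //; last first.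
  by move=> s4 F4 H4; split=> //; rewrite (frameN F4).
apply: (runs_for (n := m) (c := 107 + r * (31 + r * 26)) (I := fun j s' =>
  best_table (rarr s 1) k0 msk (2 ^ n) j (narr s' aBest))) => //=.
- by rewrite (frameN F3) // (frameN F2).
- by move=> S SN; split=> //; rewrite s3b.
- move=> j s4 jm s4j F4 H4.
  have s4k : nvar s4 vK = k0.
    by rewrite (frameN F4) // (frameN F3) // (frameN F2).
  apply: (runs_if (c := 80 + r * (31 + r * 26))) => /=; last by lia.
    rewrite s4j s4k -eqn_leq => jk.
    have s40 : narr s4 0 = narr s 0.
      by rewrite (frameA F4) // (frameA F3) // (frameA F2).
    have s41 : narr s4 1 = narr s 1.
      by rewrite (frameA F4) // (frameA F3) // (frameA F2).
    apply: (runs_block (c := 40 + r * (31 + r * 26))) => //; last first.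
      by rewrite /=; lia.
    rewrite /= s4j s40 addn1.
    set fs := narr s 0 j; set fl := _ - fs.
    have flr : fl <= r by apply: len_r.
    set s5 := set_nvar _ vFl fl.
    apply: (runs_seq (runs_mask (fl := fl) (n := n) _ _) (c2 := 22)) => //.
    + by rewrite /s5 /= (frameN F4).
    + move=> s6 F6 s6m.
      have s6F : nvar s6 vF = j by rewrite (frameN F6) ///s5 /= s4j.
      apply: (runs_weaken (runs_record (zE := rarr s 1) (k0 := k0)
        (N := 2 ^ n) (msk := msk) _ _ _ _)) => //=; rewrite ?s6F //.
      * rewrite (frameRA F6) // /s5 /= (frameRA F4) // (frameRA F3) //.
        by rewrite (frameRA F2).
      * rewrite s6m /s5 /mask_of /msk /mask_at /= s41.
        by rewrite (frameN F4 (x := vN)) // s3N (frameN F4) // s3A.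
      * by rewrite (frameA F6).
    + by nia.
  rewrite s4j s4k -eqn_leq negbK => /eqP jk.
  apply: runs_effectQ => //=; apply: best_table_keep H4 _.
  by rewrite jk eqxx.
- suff : m * (107 + r * (31 + r * 26) + 10) <= 32 + m * (200 * r ^ 2) by lia.
  by rewrite (leq_trans _ (leq_addl _ _)) // leq_mul2l; apply/orP; right; nia.
Qed.

(** * Enumerating 0-1 matrices with a binary counter *)

(** Computes [q = n./2], the matrix size [q * n] and the number of matrices, and
    sets the matrix to zero. *)
Definition sizes_prog : prog :=
  Seq (NSet vQ (NLit 0))
  (Seq (for_ vJ vN
          (If (NLe (NAdd (NAdd (NVar vQ) (NVar vQ)) (NLit 2)) (NVar vN))
              (incr vQ) Skip))
  (Seq (NSet vW (NLit 0))
  (Seq (for_ vI vQ (NSet vW (NAdd (NVar vW) (NVar vN))))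
  (Seq (pow2 vC vI vW) (clear aBits vI vW))))).

Lemma runs_sizes (R : realType) (s : state R) n :
  nvar s vN = n -> 0 < n ->
  runs sizes_prog s (200 * n ^ 2)
    (fun s' => [/\ nvar s' vQ = n./2, nvar s' vW = n./2 * n,
       nvar s' vC = 2 ^ (n./2 * n) &
       forall x, x < n./2 * n -> narr s' aBits x = 0]).
Proof.
move=> sn n0.
have n2 : n./2 * n <= n ^ 2 by rewrite leq_mul2r; lia.
have n3 : n./2 <= n ^ 2 by nia.
have n4 : n <= n ^ 2 by nia.
have n5 : 0 < n ^ 2 by rewrite expn_gt0 n0.
apply: (runs_block (c := 190 * n ^ 2)) => //; last by rewrite /=; lia.
apply: (@runs_seq _ _ _ _ (8 + n * 23) (150 * n ^ 2) _
  (fun s' => nvar s' vQ = minn n n./2)) => //; last by lia.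
  apply: (runs_for (n := n) (c := 13)
    (I := fun j s' => nvar s' vQ = minn j n./2)) => //=.
    by rewrite min0n.
  move=> j s1 jn sj F sq; apply: runs_effectQ => //=.
  rewrite (frameN F (x := vN)) // /= sn sq.
  by case: ifP => /= H; rewrite ?sq; lia.
move=> s1 F1 s1q.
have {}s1q : nvar s1 vQ = n./2 by rewrite s1q; lia.
have s1n : nvar s1 vN = n by rewrite (frameN F1).
apply: (runs_block (c := 145 * n ^ 2)) => //; last by rewrite /=; lia.
apply: (@runs_seq _ _ _ _ (8 + n./2 * 14) (120 * n ^ 2) _
  (fun s' => nvar s' vW = n./2 * n)) => //; last by lia.
  apply: (runs_for (n := n./2) (c := 4)
    (I := fun j s' => nvar s' vW = j * n)) => //=.
  move=> j s2 jn sj F sq; apply: runs_effectQ => //=.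
  by rewrite (frameN F (x := vN)) // /= s1n sq mulSn addnC.
move=> s2 F2 s2w.
apply: (runs_seq (runs_pow2 (n := n./2 * n) _ _ _ _)
  (c2 := 50 * n ^ 2)) => //; last by lia.
move=> s3 F3 s3c.
apply: (runs_weaken (runs_clear (n := n./2 * n) _ _ _)) => //; last by lia.
  by rewrite (frameN F3).
move=> s4 F4 H4; split=> //; rewrite (frameN F4) // (frameN F3) //.
by rewrite (frameN F2).
Qed.

(** Binary digit [p] of [t], the least significant digit being digit 0. *)
Definition bit (t p : nat) : bool := odd (t %/ 2 ^ p).

Lemma bitS t p : bit t.+1 p = (2 ^ p %| t.+1) (+) bit t p.
Proof. by rewrite /bit divnS ?expn_gt0 // oddD oddb. Qed.

Lemma dvdn_exp2S t p :
  (2 ^ p.+1 %| t.+1) = (2 ^ p %| t.+1) && bit t p.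
Proof.
rewrite expnS; case: (boolP (2 ^ p %| t.+1)) => H; last first.
  by apply: contraNF H; apply: dvdn_trans; apply: dvdn_mull.
rewrite -dvdn_divRL // dvdn2 -/(bit t.+1 p) bitS H /=.
by rewrite negbK.
Qed.

Lemma bits_surj (g : nat -> bool) W :
  exists2 t, t < 2 ^ W & forall p, p < W -> bit t p = g p.
Proof.
elim: W g => [|W IH] g; first by exists 0.
have [t tW Ht] := IH (fun p => g p.+1).
exists (g 0 + t.*2); first by rewrite expnS; case: (g 0); lia.
case=> [|p] pW; first by rewrite /bit expn0 divn1 oddD oddb odd_double addbF.
by rewrite /bit expnS divnMA divn2 half_bit_double -/(bit t p) Ht.
Qed.

(** Adds one to the counter, modulo [2 ^ W]; array [aBits] holds its binary
    digits. *)
Definition increment_prog : prog :=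
  Seq (NSet vCarry (NLit 1))
    (for_ vI vW
       (If (NLe (NLit 1) (NVar vCarry))
           (If (NLe (NLit 1) (NGet aBits (NVar vI)))
               (NPut aBits (NVar vI) (NLit 0))
               (Seq (NPut aBits (NVar vI) (NLit 1)) (NSet vCarry (NLit 0))))
           Skip)).

Lemma runs_increment (R : realType) (s : state R) W t :
  nvar s vW = W -> (forall x, x < W -> narr s aBits x = bit t x) ->
  runs increment_prog s (10 + W * 30)
    (fun s' => forall x, x < W -> narr s' aBits x = bit t.+1 x).
Proof.
move=> sW sb.
apply: (runs_block (c := 8 + W * 30)) => //.
set s1 := effect _ _.
(* Below the current position the digits are those of [t.+1]; the carry survives
   as long as the digits of [t] seen so far are all ones. *)
apply: (@runs_weaken _ _ _ (8 + W * 30) _ (fun s' =>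
   nvar s' vCarry = (2 ^ W %| t.+1) /\
   forall x, x < W -> narr s' aBits x = bit (if x < W then t.+1 else t) x)).
- apply: (runs_for (n := W) (c := 20) (I := fun j s' =>
   nvar s' vCarry = (2 ^ j %| t.+1) /\
   forall x, x < W ->
     narr s' aBits x = bit (if x < j then t.+1 else t) x)) => //=.
    by rewrite expn0 dvd1n.
  move=> j s2 jW sj F [sc sx]; apply: runs_effectQ => //=.
  have jj := sx j jW; rewrite ltnn in jj.
  have nx x : (x < j.+1) = (x == j) || (x < j) by rewrite ltnS leq_eqVlt.
  rewrite sc dvdn_exp2S; have := bitS t j; move: sc.
  case: (2 ^ j %| t.+1) => /= sc Hj; last first.
    split=> // x xW; rewrite nx sx //; case: eqP => [->|_] //=.
    by rewrite ltnn Hj.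
  rewrite /= sj jj; case: (bit t j) Hj => /= Hj; rewrite ?sc; split=> // x xW;
    rewrite nx; case: eqP => [->|_] //=; rewrite ?Hj //; exact: sx.
- by move=> s' F [_ H] x xW; rewrite H // xW.
- by [].
Qed.

(** * Testing a family of traces *)

(** A 0-1 matrix with [q] rows and [n] columns is given by its entries [g] in
    row-major order.  Columns stand for the nodes of the center, and nonzero
    rows for the traces of the neighbors on it; [best] is a table of edges for
    the traces, [zE] and [zV] are the values of the edges and of the columns. *)
Section Candidate.
Variables (R : realType) (n q : nat) (best : nat -> nat) (zE zV : nat -> R).
Variables (k0 : nat) (g : nat -> bool).

(** The number of ones in column [j] within the first [i] rows. *)
Definition coverage (i j : nat) : nat := \sum_(x <- iota 0 i) g (x * n + j).

(** The code of row [i]; it is 0 exactly when the row is zero. *)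
Definition row_mask (i : nat) : nat := num (fun j => g (i * n + j)) n.

(** The number of columns in which row [i] has the only one. *)
Definition own_count (i : nat) : nat :=
  \sum_(j <- iota 0 n) (g (i * n + j) && (coverage q j <= 1)).

(** Row [i] is zero, or it is the trace of a tabulated edge and owns at least two
    columns. *)
Definition row_ok (i : nat) : bool :=
  (row_mask i == 0) || (2 <= own_count i) && (0 < best (row_mask i)).

(** The numbers of the tabulated edges for the nonzero rows among the first
    [k]. *)
Definition chosen (k : nat) : seq nat :=
  [seq (best (row_mask i)).-1 | i <- iota 0 k & row_mask i != 0].

(** The right-hand side of [flower_ineqE] for the chosen edges; the columns
    without a one are the uncovered nodes. *)
Definition weight : R :=
  (\sum_(f <- chosen q) (1 - zE f) +
   \sum_(j <- iota 0 n | coverage q j == 0%N) (1 - zV j))%R.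

(** The nonzero rows are traces of neighbors that form a flower violated at the
    center [k0]. *)
Definition violating : bool :=
  [&& all row_ok (iota 0 q), chosen q != [::] & (weight < 1 - zE k0)%R].

Lemma chosenS k :
  chosen k.+1 = chosen k ++
    (if row_mask k != 0 then [:: (best (row_mask k)).-1] else [::]).
Proof. by rewrite /chosen iota0S filter_cat map_cat /=; case: ifP. Qed.

End Candidate.

(** Counts the ones in each column. *)
Definition count_prog : prog :=
  Seq (clear aCov vJ vN)
  (Seq (NSet vPos (NLit 0))
     (for_ vI vQ
        (for_ vJ vN
           (Seq (NPut aCov (NVar vJ)
                   (NAdd (NGet aCov (NVar vJ)) (NGet aBits (NVar vPos))))
                (incr vPos))))).

Lemma runs_count (R : realType) (s : state R) n q (g : nat -> bool) :
  nvar s vN = n -> nvar s vQ = q ->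
  (forall x, x < q * n -> narr s aBits x = g x) ->
  runs count_prog s (20 + n * 13 + q * (20 + n * 30))
    (fun s' => forall j, j < n -> narr s' aCov j = coverage n g q j).
Proof.
move=> sn sq sb.
apply: (runs_seq (runs_clear (n := n) _ _ _)
  (c2 := 12 + q * (20 + n * 30))) => //; last by lia.
move=> s1 F1 s1c.
apply: (runs_block (c := 10 + q * (20 + n * 30))) => //.
apply: (@runs_weaken _ _ _ (10 + q * (20 + n * 30)) _ (fun s' =>
  nvar s' vPos = q * n /\
  forall j, j < n -> narr s' aCov j = coverage n g q j)) => //; last first.
  by move=> s' _ [].
apply: (runs_for (n := q) (c := 8 + n * 22) (I := fun i s' =>
  nvar s' vPos = i * n /\
  forall j, j < n -> narr s' aCov j = coverage n g i j)) => //=.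
- by rewrite (frameN F1).
- by split=> // j jn; rewrite s1c // /coverage big_nil.
- move=> i s2 iq s2i F2 [s2p s2c].
  have s2n : nvar s2 vN = n by rewrite (frameN F2) //= (frameN F1).
  have s2b : narr s2 aBits = narr s aBits.
    by rewrite (frameA F2) //= (frameA F1).
  apply: (@runs_weaken _ _ _ (8 + n * 22) _ (fun s' =>
    nvar s' vPos = i * n + n /\
    forall x, x < n ->
      narr s' aCov x = coverage n g i x + (x < n) * g (i * n + x))).
  + apply: (runs_for (n := n) (c := 12) (I := fun j s' =>
    nvar s' vPos = i * n + j /\
    forall x, x < n ->
      narr s' aCov x = coverage n g i x + (x < j) * g (i * n + x))) => //=.
      by rewrite addn0; split=> // x xn; rewrite s2c // addn0.
    move=> j s3 jn s3j F3 [s3p s3c]; apply: runs_effectQ => //=.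
    split=> [|x xn]; first by rewrite s3p addn1 addnS.
    rewrite s3j s3p (frameA F3 (a := aBits)) // s2b sb; last by nia.
    rewrite ltnS leq_eqVlt s3c // s3c // ltnn; case: eqP => [->|_] //=.
    by rewrite !addn0 mul1n.
  + move=> s' _ [sp sx] /=; split; first by rewrite sp mulSn addnC.
    move=> j jn; rewrite sx // jn mul1n /coverage iota0S big_cat /= big_seq1 //.
  + by [].
- lia.
Qed.

(** The code of the current row and the number of columns that it owns. *)
Definition row_scan_prog : prog :=
  for_ vJ vN
    (Seq (NSet vMask (NAdd (NAdd (NVar vMask) (NVar vMask))
                           (NGet aBits (NVar vPos))))
    (Seq (If (BAnd (NLe (NLit 1) (NGet aBits (NVar vPos)))
                   (NLe (NGet aCov (NVar vJ)) (NLit 1)))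
             (incr vPriv) Skip)
         (incr vPos))).

(** Adds the current row, if nonzero, to the family, or rejects the matrix. *)
Definition row_add_prog : prog :=
  If (NLe (NLit 1) (NVar vMask))
     (If (BAnd (NLe (NLit 2) (NVar vPriv))
               (NLe (NLit 1) (NGet aBest (NVar vMask))))
         (Seq (NPut aOut (NVar vCnt)
                 (NSub (NGet aBest (NVar vMask)) (NLit 1)))
         (Seq (incr vCnt)
              (RSet wTot (RAdd (RVar wTot)
                 (RSub ROne (RGet 1 (NSub (NGet aBest (NVar vMask))
                                          (NLit 1))))))))
         (NSet vOk (NLit 0)))
     Skip.

Definition row_prog : prog :=
  Seq (Seq (NSet vMask (NLit 0)) (NSet vPriv (NLit 0)))
      (Seq row_scan_prog row_add_prog).

Lemma runs_row_scan (R : realType) (s : state R) n q (g : nat -> bool) i :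
  nvar s vN = n -> i < q ->
  (forall x, x < q * n -> narr s aBits x = g x) ->
  (forall j, j < n -> narr s aCov j = coverage n g q j) ->
  nvar s vPos = i * n -> nvar s vMask = 0 -> nvar s vPriv = 0 ->
  runs row_scan_prog s (8 + n * 50)
    (fun s' => [/\ nvar s' vPos = i.+1 * n, nvar s' vMask = row_mask n g i &
                    nvar s' vPriv = own_count n q g i]).
Proof.
move=> sn iq sb sc sp sm spr; rewrite mulSn [n + _]addnC.
apply: (runs_for (n := n) (c := 26) (I := fun j s' =>
  [/\ nvar s' vPos = i * n + j,
      nvar s' vMask = num (fun j => g (i * n + j)) j &
      nvar s' vPriv = \sum_(x <- iota 0 j)
                       (g (i * n + x) && (coverage n g q x <= 1))])) => //=.
  - by rewrite addn0 big_nil; split.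
- move=> j s1 jn sj F [s1p s1m s1r]; apply: runs_effectQ => //=.
  have E : narr s1 aBits (i * n + j) = g (i * n + j).
    by rewrite (frameA F) // sb //; nia.
  have C : narr s1 aCov j = coverage n g q j.
    by rewrite (frameA F) // sc.
  rewrite iota0S big_cat /= big_seq1 s1p sj E C.
  by case: ifP => /=; rewrite ?s1m ?s1r ?s1p ?E;
    case: (g _) => //=; case: (_ <= 1) => //= _; split=> //; lia.
- lia.
Qed.

Lemma runs_row_add (R : realType) (s : state R) n q g i best (zE : nat -> R) :
  rarr s 1 = zE -> narr s aBest = best ->
  nvar s vMask = row_mask n g i -> nvar s vPriv = own_count n q g i ->
  nvar s vOk = all (row_ok n q best g) (iota 0 i) ->
  (nvar s vOk = 1 ->
     mkseq (narr s aOut) (nvar s vCnt) = chosen n best g i /\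
     rvar s wTot = (\sum_(f <- chosen n best g i) (1 - zE f))%R) ->
  runs row_add_prog s 50
    (fun s' => nvar s' vOk = all (row_ok n q best g) (iota 0 i.+1) /\
       (nvar s' vOk = 1 ->
        mkseq (narr s' aOut) (nvar s' vCnt) = chosen n best g i.+1 /\
        rvar s' wTot = (\sum_(f <- chosen n best g i.+1) (1 - zE f))%R)).
Proof.
move=> sz sbest sm sp sok H.
have -> : all (row_ok n q best g) (iota 0 i.+1) =
    all (row_ok n q best g) (iota 0 i) && row_ok n q best g i.
  by rewrite iota0S all_cat all_seq1.
apply: runs_effectQ => //=.
rewrite sz sbest sm sp chosenS /row_ok.
case: posnP => [m0|m0] /=; first by rewrite cats0 andbT.
case: (boolP (_ && _)) => /= [_|_]; last by rewrite andbF; split.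
rewrite andbT addn1 subn1; split=> // ok1; have [mk ->] := H ok1.
split; last by rewrite big_cat big_seq1.
rewrite -mk /mkseq iota0S map_cat /= eqxx.
congr (_ ++ _); apply/eq_in_map => x; rewrite mem_iota /= => /ltn_eqF xs.
by rewrite /= xs.
Qed.

Definition verdict_prog : prog :=
  If (BAnd (NLe (NLit 1) (NVar vOk))
        (BAnd (NLe (NLit 1) (NVar vCnt))
              (BNot (RLe (RSub ROne (RGet 1 (NVar vK))) (RVar wTot)))))
     (Seq (NSet vFound (NLit 1)) (NSet vCenter (NVar vK)))
     Skip.

(** Tests the current matrix. *)
Definition check_prog : prog :=
  Seq count_prog
  (Seq (Seq (NSet vCnt (NLit 0)) (Seq (NSet vOk (NLit 1))
         (Seq (RSet wTot RZero) (NSet vPos (NLit 0)))))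
  (Seq (for_ vI vQ row_prog)
  (Seq (for_ vJ vN
          (If (NLe (NGet aCov (NVar vJ)) (NLit 0))
              (RSet wTot (RAdd (RVar wTot)
                 (RSub ROne (RGet 0 (NGet 1 (NAdd (NVar vA) (NVar vJ)))))))
              Skip))
     verdict_prog))).

(** The value of the [j]-th node of the center. *)
Definition center_weight (R : realType) (s : state R) (j : nat) : R :=
  rarr s 0 (narr s 1 (nvar s vA + j)).

(** In [s'] the matrix [g] has been recorded as a solution for the center given
    by [s]. *)
Definition found_at (R : realType) (s : state R) (n q : nat) (s' : state R)
    (g : nat -> bool) : Prop :=
  [/\ nvar s' vFound = 1, nvar s' vCenter = nvar s vK,
      violating n q (narr s aBest) (rarr s 1) (center_weight s) (nvar s vK) g &
      mkseq (narr s' aOut) (nvar s' vCnt) = chosen n (narr s aBest) g q].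

Lemma runs_check (R : realType) (s : state R) n q (g : nat -> bool) :
  nvar s vN = n -> nvar s vQ = q -> 0 < n -> q <= n ->
  nvar s vFound = 0 ->
  (forall x, x < q * n -> narr s aBits x = g x) ->
  runs check_prog s (330 * n ^ 2)
    (fun s' => nvar s' vFound = 0 /\
       ~~ violating n q (narr s aBest) (rarr s 1) (center_weight s)
            (nvar s vK) g
       \/ found_at s n q s' g).
Proof.
move=> sn sq n0 qn sf sb.
set best := narr s aBest; set zE := rarr s 1; set zV := center_weight s.
set k0 := nvar s vK.
have q2 : q <= n ^ 2 by nia.
have q3 : q * n <= n ^ 2 by rewrite leq_mul2r qn orbT.
have n2 : n <= n ^ 2 by nia.
apply: (runs_seq (runs_count (n := n) (q := q) (g := g) _ _ _)
  (c2 := 240 * n ^ 2)) => //; last by lia.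
move=> s1 F1 s1c.
apply: (runs_block (c := 232 * n ^ 2)) => //; last by rewrite /=; lia.
set s2 := effect _ _.
pose inv i s' := nvar s' vPos = i * n /\
  (nvar s' vOk = all (row_ok n q best g) (iota 0 i) /\
   (nvar s' vOk = 1 ->
      mkseq (narr s' aOut) (nvar s' vCnt) = chosen n best g i /\
      rvar s' wTot = (\sum_(f <- chosen n best g i) (1 - zE f))%R)).
apply: (@runs_seq _ _ _ _ (8 + q * (110 + n * 50)) (64 * n ^ 2) _ (inv q));
  last by lia.
  apply: (runs_for (n := q) (c := 100 + n * 50) (I := inv)) => //.
  - by rewrite /= (frameN F1).
  - by rewrite /inv /= big_nil.
  - move=> i s3 iq s3i F3 [s3p [s3ok s3H]].
    apply: (runs_block (c := 90 + n * 50)) => //; last by rewrite /=; lia.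
    set s4 := effect _ _.
    apply: (runs_seq (runs_row_scan (n := n) (q := q) (g := g) (i := i)
      _ _ _ _ _ _ _) (c2 := 50)) => //=; last by lia.
    + by rewrite (frameN F3) //= (frameN F1).
    + by move=> x xq; rewrite (frameA F3) //= (frameA F1) // sb.
    + by move=> j jn; rewrite (frameA F3) //= s1c.
    + move=> s5 F5 [s5p s5m s5r].
      apply: (runs_weaken (runs_row_add (n := n) (q := q) (g := g) (i := i)
        (best := best) (zE := zE) _ _ s5m s5r _ _)) => //=.
      * by rewrite (frameRA F5) //= (frameRA F3) //= (frameRA F1).
      * by rewrite (frameA F5) //= (frameA F3) //= (frameA F1).
      * by rewrite (frameN F5).
      * rewrite (frameN F5 (x := vOk)) // (frameN F5 (x := vCnt)) //.
        by rewrite (frameA F5) // (frameR F5).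
      * by move=> s6 F6 H6; rewrite /inv /= (frameN F6).
  - by lia.
move=> s3 F3 [s3p [s3ok s3H]].
have s3n : nvar s3 vN = n by rewrite (frameN F3) //= (frameN F1).
have s3A : nvar s3 vA = nvar s vA by rewrite (frameN F3) //= (frameN F1).
have s3c j : j < n -> narr s3 aCov j = coverage n g q j.
  by move=> jn; rewrite (frameA F3) //= s1c.
apply: (@runs_seq _ _ _ _ (8 + n * 25) 30 _ (fun s' => nvar s' vOk = 1 ->
  rvar s' wTot = weight n q best zE zV g)); last by lia.
  apply: (runs_for (n := n) (c := 15) (I := fun j s' => nvar s' vOk = 1 ->
   rvar s' wTot = (\sum_(f <- chosen n best g q) (1 - zE f) +
   \sum_(x <- iota 0 j | coverage n g q x == 0%N) (1 - zV x))%R)) => //=.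
  - by rewrite big_nil addr0 => /s3H[].
  - move=> j s4 jn s4j F4 s4w; apply: runs_effectQ => //=.
    rewrite (frameA F4) // s4j s3c // iota0S big_cat /= leqn0 big_cons big_nil.
    case: ifP => cj /= ok1; rewrite s4w // !addr0 // -!addrA.
    congr (_ + (_ + (_ - _)))%R.
    rewrite /zV /center_weight (frameN F4) // s3A.
    rewrite !(frameRA F4, frameA F4) // !(frameRA F3, frameA F3) //=.
    by rewrite !(frameRA F1, frameA F1).
move=> s4 F4 s4w.
have s4k : nvar s4 vK = k0.
  by rewrite (frameN F4) //= (frameN F3) //= (frameN F1).
have s4f : nvar s4 vFound = 0.
  by rewrite (frameN F4) //= (frameN F3) //= (frameN F1).
have s4z : rarr s4 1 = zE.
  by rewrite (frameRA F4) //= (frameRA F3) //= (frameRA F1).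
have s4ok : nvar s4 vOk = all (row_ok n q best g) (iota 0 q).
  by rewrite (frameN F4).
apply: runs_effectQ => //=.
rewrite -ltNge s4ok s4k s4z /found_at /violating -/best -/zE -/zV -/k0.
case: (boolP (all _ _)) s4ok => /= [_|_] s4ok; last by left.
have s3ok1 : nvar s3 vOk = 1 by rewrite -(frameN F4).
have [mk _] := s3H s3ok1.
have mk4 : mkseq (narr s4 aOut) (nvar s4 vCnt) = chosen n best g q.
  by rewrite (frameN F4) // (frameA F4).
have -> : (0 < nvar s4 vCnt) = (chosen n best g q != [::]).
  by rewrite -size_eq0 -mk4 size_mkseq lt0n.
rewrite s4w //.
case: ifP => v; [right|left] => //=.
Qed.

(** Nothing is checked any more once a solution has been found, so that the
    solution is not overwritten. *)
Definition search_prog : prog :=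
  for_ vT vC (Seq (If (NLe (NVar vFound) (NLit 0)) check_prog Skip)
                  increment_prog).

Lemma runs_search (R : realType) (s : state R) n q :
  nvar s vN = n -> nvar s vQ = q -> 0 < n -> q <= n ->
  nvar s vW = q * n -> nvar s vC = 2 ^ (q * n) -> nvar s vFound = 0 ->
  (forall x, x < q * n -> narr s aBits x = 0) ->
  runs search_prog s (8 + 2 ^ (q * n) * (400 * n ^ 2))
    (fun s' => nvar s' vFound = 0 /\ (forall t, t < 2 ^ (q * n) ->
       ~~ violating n q (narr s aBest) (rarr s 1) (center_weight s) (nvar s vK)
            (bit t))
       \/ exists g, found_at s n q s' g).
Proof.
move=> sn sq n0 qn sw sc sf sb.
have q3 : q * n <= n ^ 2 by rewrite leq_mul2r qn orbT.
have n2 : 0 < n ^ 2 by rewrite expn_gt0 n0.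
apply: (@runs_weaken _ _ _ (8 + 2 ^ (q * n) * (400 * n ^ 2)) _ (fun s' =>
  (forall x, x < q * n -> narr s' aBits x = bit (2 ^ (q * n)) x) /\
  (nvar s' vFound = 0 /\ (forall t, t < 2 ^ (q * n) ->
       ~~ violating n q (narr s aBest) (rarr s 1) (center_weight s) (nvar s vK)
            (bit t))
       \/ exists g, found_at s n q s' g))); [|by move=> s' _ []|by []].
apply: (runs_for (n := 2 ^ (q * n)) (c := 30 + 360 * n ^ 2) (I := fun j s' =>
  (forall x, x < q * n -> narr s' aBits x = bit j x) /\
  (nvar s' vFound = 0 /\ (forall t, t < j ->
       ~~ violating n q (narr s aBest) (rarr s 1) (center_weight s) (nvar s vK)
            (bit t))
       \/ exists g, found_at s n q s' g))) => //=.
- split; last by left.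
  by move=> x xw; rewrite sb // /bit div0n.
- move=> t s1 tw s1t F1 [s1b H1].
  apply: (@runs_seq _ _ _ _ (20 + 330 * n ^ 2) (10 + q * n * 30) _ (fun s' =>
   (nvar s' vFound = 0 /\ (forall t', t' < t.+1 ->
       ~~ violating n q (narr s aBest) (rarr s 1) (center_weight s) (nvar s vK)
            (bit t'))
       \/ exists g, found_at s n q s' g))); last by lia.
    apply: (runs_if (c := 330 * n ^ 2)) => /=; last by lia.
      rewrite leqn0 => /eqP s1f.
      case: H1 => [[_ H1]|[g [s1f' _ _ _]]]; last by rewrite s1f in s1f'.
      apply: (runs_weaken (runs_check (n := n) (q := q) (g := bit t)
        _ _ _ _ _ _)) => //.
      + by rewrite (frameN F1).
      + by rewrite (frameN F1).
      + have wE : center_weight s1 = center_weight s.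
          by rewrite /center_weight (frameN F1) // (frameA F1) // (frameRA F1).
        rewrite /found_at wE (frameA F1) // (frameN F1 (x := vK)) //.
        rewrite (frameRA F1) //.
        move=> s2 F2 [[s2f nv]|[a b c d]]; [left|right; by exists (bit t)].
        split=> // t'; rewrite ltnS leq_eqVlt => /predU1P[-> //|]; exact: H1.
    rewrite leqn0 => s1f; apply: runs_effectQ => //=; last by lia.
    case: H1 => [[s1f0 _]|]; first by rewrite s1f0 in s1f.
    by right.
  move=> s2 F2 H2.
  apply: (runs_weaken (runs_increment (W := q * n) (t := t) _ _)) => //.
  + by rewrite (frameN F2) // (frameN F1).
  + by move=> x xw; rewrite (frameA F2) // s1b.
  + move=> s3 F3 H3; split=> //=.
    case: H2 => [[a b]|[g [a b c d]]];
      [left; split=> //|right; exists g; split=> //].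
    * by rewrite (frameN F3).
    * by rewrite /= (frameN F3).
    * by rewrite /= (frameN F3).
    * by rewrite /= (frameA F3) // (frameN F3).
- by rewrite leq_add2l leq_mul2l; apply/orP; right; lia.
Qed.

(** * Flower inequalities and 0-1 matrices *)

Lemma flower_ineqE (R : realType) (G : hypergraph) (z : node G + edge G -> R)
    (e0 : edge G) (T : {set edge G}) :
  flower_ineq z e0 T <->
  (1 - z (inr e0) <= \sum_(e in T) (1 - z (inr e)) +
                     \sum_(v in uncovered e0 T) (1 - z (inl v)))%R.
Proof.
rewrite /flower_ineq !sumrB !sumr_const.
by split=> H; lra.
Qed.

(** The nodes of [e0] that lie in [e] and in no other member of [T]. *)
Definition own_nodes (G : hypergraph) (e0 : edge G) (T : {set edge G})
    (e : edge G) : {set node G} :=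
  (nodes_of e0 :&: nodes_of e)
    :\: \bigcup_(f in T :\ e) (nodes_of e0 :&: nodes_of f).

Lemma own_nodesP (G : hypergraph) (e0 : edge G) (T : {set edge G}) e v :
  reflect [/\ v \in nodes_of e0, v \in nodes_of e &
             forall f, f \in T -> v \in nodes_of f -> f = e]
          (v \in own_nodes e0 T e).
Proof.
rewrite inE inE; apply: (iffP andP) => [[nv /andP[v0 ve]]|[v0 ve H]].
  split=> // f fT vf; apply/eqP; apply: contraNT nv => fe.
  by apply/bigcupP; exists f; rewrite !inE ?fe ?v0.
split; last by rewrite v0.
apply/negP => /bigcupP[f]; rewrite !inE => /andP[fe fT] /andP[_ vf].
by rewrite (H f) ?eqxx in fe.
Qed.

Lemma uncoveredP (G : hypergraph) (e0 : edge G) (T : {set edge G}) v :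
  (v \in uncovered e0 T) =
  (v \in nodes_of e0) && [forall e in T, v \notin nodes_of e].
Proof.
rewrite inE andbC; congr (_ && _); apply/idP/forall_inP.
  by move=> H e eT; apply: contra H => ve; apply/bigcupP; exists e.
by move=> H; apply/negP => /bigcupP[e eT]; apply/negP; apply: H.
Qed.

(** Double counting: every node of [e0] is owned by at most one member of [T],
    and every member owns at least two nodes. *)
Lemma flower_card (G : hypergraph) (e0 : edge G) (T : {set edge G}) :
  flower e0 T -> #|T| <= #|nodes_of e0|./2.
Proof.
case=> _ _ own2; suff : #|T| * 2 <= #|nodes_of e0| by lia.
apply: (@leq_trans (\sum_(e in T) #|own_nodes e0 T e|)).
  by rewrite -sum_nat_const; apply: leq_sum => e /own2.
under eq_bigr => e _ do rewrite -sum1_card big_mkcond /=.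
rewrite exchange_big /= -sum1_card [leqRHS]big_mkcond /=.
apply: leq_sum => v _; rewrite -big_mkcondr /= sum1_card.
case: ifP => v0.
  apply/card_le1_eqP => e f; rewrite -!topredE /= => /andP[eT ve] /andP[fT vf].
  case/own_nodesP: ve => _ _ H; case/own_nodesP: vf => _ vf _; exact: H.
rewrite leqn0; apply/eqP; apply: eq_card0 => e; rewrite -topredE /=.
by apply/negP => /andP[_ /own_nodesP[]]; rewrite v0.
Qed.

(** The columns stand for the nodes of [e0], listed in [nds]; the functions
    [zE], [zV] and [msk] need only be meaningful on edge numbers and columns.
    The default values [e0] and [v0] of list lookups are never reached. *)
Section Rows.
Variables (R : realType) (G : hypergraph) (L : numbering G).
Variables (z : node G + edge G -> R) (e0 : edge G) (v0 : node G).
Variables (nds : seq (node G)) (best : nat -> nat).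
Hypothesis nds_uniq : uniq nds.
Hypothesis mem_nds : nds =i nodes_of e0.

Let n := size nds.
Let q := n./2.
Let nd (j : nat) : node G := nth v0 nds j.
Let ed (f : nat) : edge G := nth e0 (edge_list L) f.
Variables (zE zV : nat -> R) (msk : nat -> nat).
Hypothesis zE_ok : forall f, f < #|edge G| -> zE f = z (inr (ed f)).
Hypothesis zV_ok : forall j, j < n -> zV j = z (inl (nd j)).
Hypothesis msk_ok : forall f, f < #|edge G| ->
  msk f = num (fun j => nd j \in nodes_of (ed f)) n.
Hypothesis best_ok :
  best_table zE (edge_num L e0) msk (2 ^ n) #|edge G| best.

Lemma edge_list_uniq : uniq (edge_list L).
Proof. by rewrite (perm_uniq (edge_listP L)) enum_uniq. Qed.

Lemma mem_edge_list e : e \in edge_list L.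
Proof. by rewrite (perm_mem (edge_listP L)) mem_enum. Qed.

Lemma size_edge_list : size (edge_list L) = #|edge G|.
Proof. by rewrite (perm_size (edge_listP L)) -cardE. Qed.

Lemma edge_num_lt e : edge_num L e < #|edge G|.
Proof. by rewrite -size_edge_list index_mem mem_edge_list. Qed.

Lemma ed_num e : ed (edge_num L e) = e.
Proof. by rewrite /ed nth_index // mem_edge_list. Qed.

Lemma num_ed f : f < #|edge G| -> edge_num L (ed f) = f.
Proof.
by move=> fm; rewrite /edge_num index_uniq ?edge_list_uniq ?size_edge_list.
Qed.

Lemma card_e0 : #|nodes_of e0| = n.
Proof. by rewrite -(eq_card mem_nds); apply/card_uniqP. Qed.

Lemma nds_nd : nds = [seq nd j | j <- iota 0 n].
Proof. by rewrite -/(mkseq nd n) mkseq_nth. Qed.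

Lemma sum_nodes (P : pred (node G)) (F : node G -> R) :
  (\sum_(j <- iota 0 n | P (nd j)) F (nd j) =
   \sum_(v in nodes_of e0 | P v) F v)%R.
Proof.
have -> : (\sum_(j <- iota 0 n | P (nd j)) F (nd j) =
           \sum_(v <- nds | P v) F v)%R by rewrite nds_nd big_map.
rewrite -big_filter -[RHS]big_filter; apply: perm_big.
apply: uniq_perm; rewrite ?filter_uniq ?index_enum_uniq // => v.
by rewrite !mem_filter mem_index_enum andbT mem_nds andbC.
Qed.

Lemma count_nodes (P : nat -> bool) (Q : {set node G}) :
  (forall j, j < n -> P j = (nd j \in Q)) -> Q \subset nodes_of e0 ->
  \sum_(j <- iota 0 n) P j = #|Q|.
Proof.
move=> PQ sub; rewrite -sum1_card.
have -> : \sum_(j <- iota 0 n) P j = \sum_(j <- iota 0 n | nd j \in Q) 1.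
  rewrite [RHS]big_mkcond; apply: eq_big_seq => j.
  by rewrite mem_iota /= => jn; rewrite PQ //; case: (_ \in _).
have -> : \sum_(j <- iota 0 n | nd j \in Q) 1 = \sum_(v <- nds | v \in Q) 1.
  by rewrite nds_nd big_map.
rewrite -big_filter -[RHS]big_filter; apply: perm_big.
apply: uniq_perm; rewrite ?filter_uniq ?index_enum_uniq // => v.
rewrite !mem_filter mem_index_enum andbT mem_nds andbC.
by case vQ: (v \in Q); rewrite ?andbF // andbT (subsetP sub).
Qed.

(** A matrix that passes the test describes a violated flower. *)
Section Sound.
Variable g : nat -> bool.
Hypothesis g_violating : violating n q best zE zV (edge_num L e0) g.

Let rows : seq nat := [seq i <- iota 0 q | row_mask n g i != 0].
Let num_of (i : nat) : nat := (best (row_mask n g i)).-1.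

Lemma rowsP i : i \in rows ->
  [/\ num_of i < #|edge G|, ed (num_of i) != e0,
      forall j, j < n -> g (i * n + j) = (nd j \in nodes_of (ed (num_of i))) &
      2 <= own_count n q g i].
Proof.
rewrite mem_filter => /andP[m0 iq].
have /and3P[/allP/(_ i iq) + _ _] := g_violating.
rewrite /row_ok (negPf m0) /= => /andP[p2 b0].
have [_ /(_ b0)[fm fk E]] := best_ok (num_lt (fun j => g (i * n + j)) n).
split=> // [|j jn].
  by apply: contraNneq fk; rewrite -/(num_of i) => <-; rewrite num_ed.
by rewrite -(num_inj (etrans (esym (msk_ok fm)) E)).
Qed.

Lemma coverage_ge i i' j : i < q -> i' < q -> i != i' ->
  g (i * n + j) -> g (i' * n + j) -> 1 < coverage n g q j.
Proof.
move=> iq i'q ii' gi gi'; rewrite /coverage.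
rewrite (big_rem i) ?mem_iota //= gi (big_rem i') /= ?gi' //.
by rewrite mem_rem_uniq ?iota_uniq // !inE eq_sym ii' mem_iota.
Qed.

(** Rows with the same edge are equal, and equal rows own no column. *)
Lemma num_of_inj : {in rows &, injective num_of}.
Proof.
move=> i i' iR i'R E; apply: contraTeq isT => ii'.
have [_ _ gi p2] := rowsP iR; have [_ _ gi' _] := rowsP i'R.
have iq : i < q by move: iR; rewrite mem_filter mem_iota => /andP[].
have i'q : i' < q by move: i'R; rewrite mem_filter mem_iota => /andP[].
move: p2; rewrite /own_count big_seq big1 // => j; rewrite mem_iota /= => jn.
case: (boolP (g _)) => //= gij; rewrite leqNgt (coverage_ge iq i'q ii' gij) //.
by rewrite gi' // -E -gi.
Qed.

Let T : {set edge G} := [set e in [seq ed f | f <- chosen n best g q]].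

Lemma chosenE : chosen n best g q = [seq num_of i | i <- rows].
Proof. by []. Qed.

Lemma chosen_uniq : uniq (chosen n best g q).
Proof.
rewrite chosenE map_inj_in_uniq ?filter_uniq ?iota_uniq //.
exact: num_of_inj.
Qed.

Lemma chosen_lt f : f \in chosen n best g q -> f < #|edge G|.
Proof. by rewrite chosenE => /mapP[i /rowsP[fm _ _ _] ->]. Qed.

Lemma enum_chosen :
  perm_eq (enum T) [seq ed f | f <- chosen n best g q].
Proof.
apply: uniq_perm; rewrite ?enum_uniq //.
  rewrite map_inj_in_uniq ?chosen_uniq // => f f' /chosen_lt fm /chosen_lt f'm.
  by move=> E; rewrite -(num_ed fm) E num_ed.
by move=> e; rewrite mem_enum inE.
Qed.

Lemma chosen_perm :
  perm_eq (chosen n best g q) [seq edge_num L e | e in T].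
Proof.
rewrite perm_sym; apply: perm_trans (perm_map _ enum_chosen) _.
rewrite -map_comp map_id_in // => f /chosen_lt; exact: num_ed.
Qed.

Lemma chosenP e :
  reflect (exists2 i, i \in rows & e = ed (num_of i)) (e \in T).
Proof.
rewrite inE chosenE -map_comp.
by apply: (iffP mapP) => -[i iR ->]; exists i.
Qed.

Lemma coverage_eq0 j : j < n ->
  (coverage n g q j == 0) = [forall e in T, nd j \notin nodes_of e].
Proof.
move=> jn; rewrite /coverage sum_nat_seq_eq0; apply/allP/forall_inP => H.
  move=> e /chosenP[i iR ->]; have [_ _ <- // _] := rowsP iR.
  have iq : i \in iota 0 q by move: iR; rewrite mem_filter => /andP[].
  by have := H i iq; case: (g _).
move=> i iq /=; case: (boolP (g _)) => //= gij.
have iR : i \in rows.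
  rewrite mem_filter iq andbT /row_mask num_eq0 negbK.
  by apply/hasP; exists j; rewrite ?mem_iota.
have [_ _ gi _] := rowsP iR.
have eT : ed (num_of i) \in T by apply/chosenP; exists i.
by have := H _ eT; rewrite -gi // gij.
Qed.

Lemma violating_sound :
  [/\ perm_eq (chosen n best g q) [seq edge_num L e | e in T], flower e0 T
    & ~ flower_ineq z e0 T].
Proof.
have [_ c0 wlt] := and3P g_violating; split; first exact: chosen_perm.
  split.
  - apply: contraNneq c0 => T0; have := perm_size chosen_perm.
    by rewrite size_image T0 cards0 -size_eq0 => ->.
  - move=> e /chosenP[i iR ->]; have [_ e0i gi _] := rowsP iR.
    rewrite /adjacent eq_sym e0i /=.
    move: (iR); rewrite mem_filter /row_mask num_eq0 negbK => /andP[/hasP[j]].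
    rewrite mem_iota /= => jn gij _; apply/set0Pn; exists (nd j).
    by rewrite inE -mem_nds mem_nth // -gi.
  - move=> e /chosenP[i iR ->]; have [_ _ gi p2] := rowsP iR.
    apply: leq_trans p2 _; rewrite -/(own_nodes e0 T _).
    set Q := own_nodes _ _ _.
    have subQ : Q \subset nodes_of e0.
      by apply/subsetP => v /own_nodesP[].
    rewrite -(count_nodes (P := fun j => nd j \in Q)) // /own_count.
    rewrite big_seq [leqRHS]big_seq.
    apply: leq_sum => j; rewrite mem_iota /= => jn.
    case: (boolP (g _)) => //= gij; case: (boolP (_ <= 1)) => //= cj.
    have -> : nd j \in Q; last by [].
    apply/own_nodesP; split; rewrite -?gi -?mem_nds ?mem_nth //.
    move=> f /chosenP[i' i'R ->]; have [_ _ gi' _] := rowsP i'R.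
    rewrite -gi' // => gi'j; have [-> //|ii'] := eqVneq i i'.
    move: iR i'R; rewrite !mem_filter !mem_iota => /andP[_ iq] /andP[_ i'q].
    by have := coverage_ge iq i'q ii' gij gi'j; rewrite ltnNge cj.
move/flower_ineqE; apply/negP; rewrite -ltNge.
rewrite zE_ok ?edge_num_lt // ed_num in wlt; apply: le_lt_trans wlt.
rewrite /weight lerD //.
  have -> : (\sum_(f <- chosen n best g q) (1 - zE f) =
     \sum_(e <- [seq ed f | f <- chosen n best g q]) (1 - z (inr e)))%R.
    rewrite [RHS]big_map; apply: eq_big_seq => f /chosen_lt fm.
    by rewrite zE_ok.
  by rewrite -(perm_big _ enum_chosen) /= big_enum.
have -> : (\sum_(j <- iota 0 n | coverage n g q j == 0%N) (1 - zV j) =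
  \sum_(j <- iota 0 n | [forall e in T, nd j \notin nodes_of e])
    (1 - z (inl (nd j))))%R.
  rewrite big_seq_cond [RHS]big_seq_cond; apply: eq_big => j; last first.
    by rewrite mem_iota => /andP[/= jn _]; rewrite zV_ok.
  by rewrite mem_iota /=; case: ltnP => //= jn; rewrite coverage_eq0.
rewrite (sum_nodes (fun v => [forall e in T, v \notin nodes_of e])
  (fun v => 1 - z (inl v))%R) le_eqVlt; apply/orP; left; apply/eqP.
by apply: eq_bigl => v; rewrite uncoveredP.
Qed.

End Sound.

(** The matrix whose rows are the traces of a violated flower, followed by zero
    rows, passes the test. *)
Section Complete.
Variables (T : {set edge G}) (g : nat -> bool).
Hypothesis T_flower : flower e0 T.
Hypothesis T_violated : ~ flower_ineq z e0 T.
Let te (i : nat) : edge G := nth e0 (enum T) i.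
Hypothesis gT : forall i j, i < q -> j < n ->
  g (i * n + j) = (i < #|T|) && (nd j \in nodes_of (te i)).

Lemma cardT_le : #|T| <= q.
Proof. by rewrite /q -card_e0; apply: flower_card. Qed.

Lemma te_in i : i < #|T| -> te i \in T.
Proof. by move=> iT; rewrite -mem_enum mem_nth // -cardE. Qed.

Lemma sum_iota_T (F : edge G -> nat) :
  \sum_(i <- iota 0 q) (i < #|T|) * F (te i) = \sum_(e in T) F e.
Proof.
rewrite -(subnKC cardT_le) iotaD big_cat /=.
rewrite [X in _ + X]big1_seq ?addn0; last first.
  move=> i; rewrite mem_iota add0n => /andP[_ /andP[Ti _]].
  by rewrite ltnNge Ti.
rewrite -big_enum -[enum T](mkseq_nth e0) /mkseq -cardE big_map.
by apply: eq_big_seq => i; rewrite mem_iota /= => iT; rewrite iT mul1n.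
Qed.

Lemma coverage_T j : j < n ->
  coverage n g q j = \sum_(e in T) (nd j \in nodes_of e).
Proof.
move=> jn; rewrite -sum_iota_T; apply: eq_big_seq => i.
by rewrite mem_iota /= => iq; rewrite gT // -mulnb.
Qed.

Lemma row_mask_T i : i < #|T| -> row_mask n g i = msk (edge_num L (te i)).
Proof.
move=> iT; rewrite msk_ok ?edge_num_lt //; apply: eq_num => j jn.
rewrite ed_num gT ?iT //; exact: leq_trans cardT_le.
Qed.

Lemma row_mask_notT i : i < q -> #|T| <= i -> row_mask n g i = 0.
Proof.
move=> iq Ti; apply/eqP; rewrite num_eq0; apply/hasPn => j.
by rewrite mem_iota /= => jn; rewrite gT // ltnNge Ti.
Qed.

Lemma own_count_T i : i < #|T| -> 2 <= own_count n q g i.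
Proof.
move=> iT; have iq : i < q := leq_trans iT cardT_le.
have [_ _ /(_ _ (te_in iT)) own2] := T_flower.
apply: leq_trans own2 _; rewrite -/(own_nodes e0 T _).
set Q := own_nodes _ _ _.
have subQ : Q \subset nodes_of e0 by apply/subsetP => v /own_nodesP[].
rewrite -(count_nodes (P := fun j => nd j \in Q)) // /own_count big_seq.
rewrite [leqRHS]big_seq; apply: leq_sum => j; rewrite mem_iota /= => jn.
case: (boolP (_ \in _)) => //= /own_nodesP[_ ji H].
rewrite gT // iT ji coverage_T // (bigD1 (te i)) ?te_in //= ji big1 // => f.
case/andP=> fT fi; case: (boolP (_ \in _)) => // /(H _ fT)/eqP.
by rewrite (negPf fi).
Qed.

Lemma row_mask_T_neq0 i : i < #|T| -> row_mask n g i != 0.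
Proof.
move=> iT; apply: contraTneq (own_count_T iT); rewrite -ltnNge => /eqP.
rewrite num_eq0 => /hasPn H; rewrite /own_count big_seq big1 // => j jn.
by rewrite (negPf (H j jn)).
Qed.

Lemma best_T i : i < #|T| -> 0 < best (row_mask n g i) /\
  (z (inr (te i)) <= zE (best (row_mask n g i)).-1)%R.
Proof.
move=> iT; have [H _] := best_ok (num_lt (fun j => g (i * n + j)) n).
have [||//|b0 zb] := H (edge_num L (te i)).
- exact: edge_num_lt.
- have [_ /(_ _ (te_in iT))/andP[e0i _] _] := T_flower.
  by apply: contraNneq e0i => E; rewrite -(ed_num e0) -E ed_num.
- by rewrite -row_mask_T.
- by split=> //; rewrite zE_ok ?edge_num_lt ?ed_num in zb.
Qed.

Lemma violating_complete :
  violating n q best zE zV (edge_num L e0) g.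
Proof.
have iotaT : [seq i <- iota 0 q | row_mask n g i != 0] = iota 0 #|T|.
  rewrite -(subnKC cardT_le) iotaD filter_cat.
  rewrite [X in X ++ _](_ : _ = iota 0 #|T|); last first.
    apply/all_filterP/allP => i; rewrite mem_iota /=; exact: row_mask_T_neq0.
  rewrite (eq_in_filter (a2 := pred0)) ?filter_pred0 ?cats0 // => i.
  rewrite mem_iota add0n subnKC ?cardT_le // => /andP[Ti iq].
  by rewrite row_mask_notT.
apply/and3P; split.
- apply/allP => i; rewrite mem_iota /= /row_ok => iq.
  case: (ltnP i #|T|) => iT; last by rewrite row_mask_notT.
  by rewrite own_count_T // (proj1 (best_T iT)) orbT.
- have [T0 _ _] := T_flower.
  by rewrite -size_eq0 size_map iotaT size_iota cards_eq0.
have /negP := contra_not (proj2 (flower_ineqE z e0 T)) T_violated.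
rewrite -ltNge zE_ok ?edge_num_lt // ed_num; apply: le_lt_trans.
rewrite /weight lerD //.
  rewrite /chosen iotaT big_map -big_enum -[enum T](mkseq_nth e0) /mkseq -cardE.
  rewrite big_map big_seq [leRHS]big_seq; apply: ler_sum => i.
  by rewrite mem_iota /= lerD2l lerN2 => /best_T[].
have -> : (\sum_(j <- iota 0 n | coverage n g q j == 0%N) (1 - zV j) =
  \sum_(j <- iota 0 n | [forall e in T, nd j \notin nodes_of e])
    (1 - z (inl (nd j))))%R.
  rewrite big_seq_cond [RHS]big_seq_cond; apply: eq_big => j; last first.
    by rewrite mem_iota => /andP[/= jn _]; rewrite zV_ok.
  rewrite mem_iota /=; case: ltnP => //= jn; rewrite coverage_T // sum_nat_eq0.
  by apply: eq_forallb_in => e eT; case: (_ \in _).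
rewrite (sum_nodes (fun v => [forall e in T, v \notin nodes_of e])
  (fun v => 1 - z (inl v))%R) le_eqVlt; apply/orP; left; apply/eqP.
by apply: eq_bigl => v; rewrite uncoveredP.
Qed.

End Complete.

End Rows.

(** * The separation program *)

(** The search for a violated inequality centered at edge number [vK]. *)
Definition center_prog : prog :=
  If (NLe (NVar vFound) (NLit 0))
     (Seq table_prog (Seq sizes_prog search_prog)) Skip.

(** Copies the solution to the output cells, most of which hold input data
    during the search. *)
Definition finish_prog : prog :=
  Seq (If (NLe (NLit 1) (NVar vFound))
          (for_ vI vCnt (NPut 0 (NVar vI) (NGet aOut (NVar vI)))) Skip)
      (Seq (NSet 0 (NVar vFound))
           (Seq (NSet 1 (NVar vCenter)) (NSet 2 (NVar vCnt)))).

Definition main_prog : prog := Seq (for_ vK vM center_prog) finish_prog.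

Lemma has_nth (l : seq nat) y :
  has (fun x => nth 0 l x == y) (iota 0 (size l)) = (y \in l).
Proof.
apply/hasP/idP => [[x]|yl].
  by rewrite mem_iota /= => xl /eqP <-; rewrite mem_nth.
by exists (index y l); rewrite ?mem_iota ?index_mem // nth_index.
Qed.

Section Input.
Variables (R : realType) (G : hypergraph) (L : numbering G).
Variable z : node G + edge G -> R.

Let flat : nat -> nat :=
  nth 0 (flatten [seq vertex_list L e | e <- edge_list L]).

(** The nodes of [e] in the order of its vertex list. *)
Definition sorted_nodes (e : edge G) : seq (node G) :=
  sort (relpre (node_num L) leq) (enum (nodes_of e)).

Lemma vertex_listE e :
  vertex_list L e = [seq node_num L v | v <- sorted_nodes e].
Proof. by rewrite /vertex_list /sorted_nodes -sort_map. Qed.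

Lemma sorted_nodes_uniq e : uniq (sorted_nodes e).
Proof. by rewrite sort_uniq enum_uniq. Qed.

Lemma mem_sorted_nodes e : sorted_nodes e =i nodes_of e.
Proof. by move=> v; rewrite mem_sort mem_enum. Qed.

Lemma size_sorted_nodes e : size (sorted_nodes e) = #|nodes_of e|.
Proof. by rewrite size_sort -cardE. Qed.

Lemma node_num_inj : injective (node_num L).
Proof.
move=> u v E; have H w : w \in node_list L.
  by rewrite (perm_mem (node_listP L)) mem_enum.
by rewrite -(nth_index u (H u)) -/(node_num L u) E nth_index.
Qed.

Variable e0 : edge G.

Lemma startS k : k < #|edge G| ->
  start L k.+1 = start L k + size (vertex_list L (nth e0 (edge_list L) k)).
Proof.
move=> km; rewrite /start (take_nth e0) ?size_edge_list //.
by rewrite map_rcons -cats1 sumn_cat /= addn0.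
Qed.

Lemma flat_nth k i : k < #|edge G| ->
  i < size (vertex_list L (nth e0 (edge_list L) k)) ->
  flat (start L k + i) = nth 0 (vertex_list L (nth e0 (edge_list L) k)) i.
Proof.
move=> km ik; rewrite /flat -{1}(cat_take_drop k (edge_list L)) map_cat.
rewrite flatten_cat nth_cat size_flatten /shape -map_comp -/(start L k).
rewrite ltnNge leq_addr /= addKn (drop_nth e0) ?size_edge_list //=.
by rewrite nth_cat ik.
Qed.

Lemma mask_at_input (v0 : node G) f : f < #|edge G| ->
  mask_at (start L) flat (edge_num L e0) f =
  num (fun j => nth v0 (sorted_nodes e0) j \in
                nodes_of (nth e0 (edge_list L) f)) (size (sorted_nodes e0)).
Proof.
move=> fm; have km := edge_num_lt L e0.
have sz : size (vertex_list L e0) = size (sorted_nodes e0).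
  by rewrite vertex_listE size_map.
rewrite /mask_at !startS // !addKn ed_num sz; apply: eq_num => j jn.
rewrite flat_nth ?ed_num ?sz // (vertex_listE e0) (nth_map v0) //.
rewrite (eq_in_has (a2 := fun x =>
  nth 0 (vertex_list L (nth e0 (edge_list L) f)) x
    == node_num L (nth v0 (sorted_nodes e0) j))); last first.
  by move=> x; rewrite mem_iota /= => xn; rewrite flat_nth.
by rewrite has_nth vertex_listE (mem_map node_num_inj) mem_sorted_nodes.
Qed.

(** The input data are still in place. *)
Definition has_input (s : state R) : Prop :=
  [/\ nvar s vM = #|edge G|, narr s 0 = start L, narr s 1 = flat,
      rarr s 0 = nth 0%R [seq z (inl v) | v <- node_list L] &
      rarr s 1 = nth 0%R [seq z (inr e) | e <- edge_list L]].

(** A violated inequality has been recorded. *)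
Definition has_solution (s : state R) : Prop :=
  exists (c : edge G) (T : {set edge G}),
    [/\ nvar s vFound = 1 /\ nvar s vCenter = edge_num L c,
        perm_eq (mkseq (narr s aOut) (nvar s vCnt)) [seq edge_num L e | e in T],
        flower c T & ~ flower_ineq z c T].

Lemma has_solution_eq s s' :
  nvar s' vFound = nvar s vFound -> nvar s' vCenter = nvar s vCenter ->
  nvar s' vCnt = nvar s vCnt -> narr s' aOut = narr s aOut ->
  has_solution s -> has_solution s'.
Proof.
move=> e1 e2 e3 e4 [c [T [[H1 H2] H3 H4 H5]]]; exists c, T.
by rewrite e1 e2 e3 e4.
Qed.

(** Bounds the operations per center, with [m] edges of at most [r] nodes. *)
Definition center_cost (m r : nat) : nat :=
  127 * 2 ^ r + m * (200 * r ^ 2) + 2 ^ (r ^ 2)./2 * (720 * r ^ 2).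

Lemma runs_center (s : state R) r :
  0 < r -> (forall e : edge G, #|nodes_of e| <= r) ->
  has_input s -> nvar s vK = edge_num L e0 -> nvar s vFound = 0 ->
  1 < #|nodes_of e0| ->
  runs center_prog s (center_cost #|edge G| r)
    (fun s' => nvar s' vFound = 0 /\
               (forall T, flower e0 T -> flower_ineq z e0 T) \/
               has_solution s').
Proof.
move=> r0 card_r [sm s0 s1 sz0 sz1] sk sf card2.
have k0m := edge_num_lt L e0.
set m := #|edge G| in sm k0m *; set k0 := edge_num L e0.
set nds := sorted_nodes e0; set n := size nds; set q := n./2.
have nE : n = #|nodes_of e0| := size_sorted_nodes e0.
have n1 : 1 < n by rewrite nE.
have nr : n <= r by rewrite nE.
have r1 : 0 < 2 ^ (r ^ 2)./2 by rewrite expn_gt0.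
have nr2 : n ^ 2 <= r ^ 2 by rewrite leq_sqr.
have qn2 : 2 ^ (q * n) <= 2 ^ (r ^ 2)./2 by rewrite leq_exp2l //; nia.
have qn3 : 2 ^ (q * n) * (400 * n ^ 2) <= 2 ^ (r ^ 2)./2 * (400 * r ^ 2).
  by rewrite leq_mul // leq_mul2l nr2 orbT.
have n3 : 200 * n ^ 2 <= 2 ^ (r ^ 2)./2 * (200 * r ^ 2).
  by apply: leq_trans (leq_pmull _ r1); rewrite leq_mul2l nr2 orbT.
have c3 : 120 <= 2 ^ (r ^ 2)./2 * (120 * r ^ 2).
  by apply: leq_trans (leq_pmull _ r1); rewrite leq_pmulr // expn_gt0 r0.
have size_e k : k < m ->
    narr s 0 k.+1 - narr s 0 k = #|nodes_of (nth e0 (edge_list L) k)|.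
  move=> km; rewrite s0 (startS km) addKn vertex_listE size_map.
  by rewrite size_sorted_nodes.
have szn : narr s 0 k0.+1 - narr s 0 k0 = n by rewrite size_e // ed_num nE.
apply: (@runs_if _ _ _ _ _ (127 * 2 ^ r + m * (200 * r ^ 2) +
  (108 + 200 * n ^ 2 + 2 ^ (q * n) * (400 * n ^ 2)))) => //=; last first.
- by rewrite /center_cost -/m; lia.
- by rewrite sf.
move=> _.
apply: (runs_seq (runs_table (m := m) (r := r) sm r0 _ _)
  (c2 := 8 + 200 * n ^ 2 + 2 ^ (q * n) * (400 * n ^ 2))) => //; last by lia.
- by move=> f fm; rewrite size_e.
- by rewrite sk.
rewrite sk szn => s2 F2 [s2A s2N s2b].
apply: (runs_seq (runs_sizes (n := n) _ _)
  (c2 := 8 + 2 ^ (q * n) * (400 * n ^ 2))) => //; [by lia| |by lia].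
move=> s3 F3 [s3q s3w s3c s3b].
have s3k : nvar s3 vK = k0 by rewrite (frameN F3) // (frameN F2).
have s3best : narr s3 aBest = narr s2 aBest by rewrite (frameA F3).
have s3z : rarr s3 1 = rarr s 1 by rewrite (frameRA F3) // (frameRA F2).
have [v0 v0e] : exists v0, v0 \in nodes_of e0.
  by apply/set0Pn; rewrite -card_gt0; lia.
have zE_ok f : f < m -> rarr s 1 f = z (inr (nth e0 (edge_list L) f)).
  by move=> fm; rewrite sz1 (nth_map e0) // size_edge_list.
have zV_ok j : j < n -> center_weight s3 j = z (inl (nth v0 nds j)).
  move=> jn; rewrite /center_weight (frameN F3) // s2A s0.
  rewrite (frameRA F3) // (frameRA F2) // (frameA F3) // (frameA F2) // sz0 s1.
  have sz : size (vertex_list L e0) = n by rewrite vertex_listE size_map.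
  rewrite flat_nth ?ed_num ?sz // vertex_listE (nth_map v0) // (nth_map v0).
    by rewrite nth_index // (perm_mem (node_listP L)) mem_enum.
  by rewrite index_mem (perm_mem (node_listP L)) mem_enum.
have nds_uniq : uniq nds := sorted_nodes_uniq e0.
have mem_nds : nds =i nodes_of e0 := mem_sorted_nodes e0.
have msk_ok f : f < m -> mask_at (narr s 0) (narr s 1) k0 f =
    num (fun j => nth v0 nds j \in nodes_of (nth e0 (edge_list L) f)) n.
  by rewrite s0 s1; apply: mask_at_input.
apply: (runs_weaken (runs_search (n := n) (q := q)
  _ s3q _ _ s3w s3c _ s3b)) => //.
- by rewrite (frameN F3).
- lia.
- by rewrite /q; lia.
- by rewrite (frameN F3) // (frameN F2).
rewrite s3best s3z s3k => s4 F4 [[s4f none]|[g [s4f s4c v mk]]].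
  left; split=> // T Tfl; apply/flower_ineqE; rewrite leNgt; apply/negP => lt1.
  have Tv : ~ flower_ineq z e0 T by move/flower_ineqE; rewrite leNgt lt1.
  (* The counter reaches the matrix whose rows are the traces of [T]. *)
  have [t tW Ht] := bits_surj (fun p => (p %/ n < #|T|) &&
     (nth v0 nds (p %% n) \in nodes_of (nth e0 (enum T) (p %/ n)))) (q * n).
  have /negP[] := none t tW.
  apply: (violating_complete nds_uniq mem_nds zE_ok zV_ok msk_ok s2b Tfl Tv).
  move=> i j iq jn; rewrite Ht; last first.
    apply: (@leq_trans (i.+1 * n)); last by rewrite leq_mul2r iq orbT.
    by rewrite mulSn addnC ltn_add2r.
  by rewrite divnMDl ?modnMDl ?divn_small ?modn_small ?addn0 //; lia.
rewrite s3k s3best s3z in s4c v mk.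
have [a b c] := violating_sound nds_uniq mem_nds zE_ok zV_ok msk_ok s2b v.
right; exists e0; eexists.
by split; [split|rewrite mk; exact: a|exact: b|exact: c].
Qed.

End Input.

Lemma runs_finish (R : realType) (G : hypergraph) (L : numbering G)
    (z : node G + edge G -> R) (s : state R) r :
  (forall e : edge G, #|nodes_of e| <= r) ->
  nvar s vFound = 0 /\
    (forall c (T : {set edge G}), flower c T -> flower_ineq z c T) \/
    has_solution L z s ->
  runs finish_prog s (30 + 14 * r) (correct_output L z).
Proof.
move=> card_r H.
apply: (@runs_seq _ _ _ _ (20 + 14 * r) 6 _ (fun s' =>
   nvar s vFound = 0 \/
   mkseq (narr s' 0) (nvar s vCnt) = mkseq (narr s aOut) (nvar s vCnt))).
- apply: (runs_if (c := 8 + 14 * r)) => /= [sf|sf|];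
    [|by apply: runs_effectQ => //; left; lia|by lia].
  case: H => [[sf0 _]|[c [T [_ pT fT _]]]]; first by rewrite sf0 in sf.
  have cnt_r : nvar s vCnt <= r.
    have := perm_size pT; rewrite size_mkseq size_image => ->.
    by have := flower_card fT; have := card_r c; lia.
  apply: (runs_weaken (runs_for (n := nvar s vCnt) (c := 4) (I := fun j s' =>
    forall x, x < j -> narr s' 0 x = narr s aOut x)
    _ _ _ _ _ _ (leqnn _))) => //=.
  + move=> j s1 jn sj F Hj; apply: runs_effectQ => //= x.
    rewrite ltnS leq_eqVlt sj (frameA F) //.
    by case: eqP => [->//|_] /= /Hj.
  + move=> s' _ H; right; apply/eq_in_map => x; rewrite mem_iota /=; exact: H.
  + lia.
- move=> s1 F1 H1; apply: runs_effectQ => //.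
  rewrite /correct_output /= !(frameN F1) //.
  case: H => [[-> nv]|[c [T [[sf sc] pT fT vT]]]]; first by [].
  case: H1 => [|mk]; first by rewrite sf.
  by rewrite sf /=; exists c, T; split=> //; rewrite mk.
- lia.
Qed.

Lemma runs_main (R : realType) (G : hypergraph) (L : numbering G)
    (z : node G + edge G -> R) r :
  0 < r -> (forall e : edge G, #|nodes_of e| <= r) ->
  runs main_prog (input L z)
    (50 + #|edge G| * (center_cost #|edge G| r + 10) + 14 * r)
    (correct_output L z).
Proof.
move=> r0 card_r; set s := input L z; set m := #|edge G|.
pose inv k (s' : state R) := nvar s' vFound = 0 /\
    (forall c (T : {set edge G}), edge_num L c < k ->
       flower c T -> flower_ineq z c T) \/
  has_solution L z s'.
apply: (@runs_seq _ _ _ _ (8 + m * (center_cost m r + 10)) (30 + 14 * r) _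
  (inv m)).
- apply: (runs_for (n := m) (c := center_cost m r) (I := inv)) => //=.
    by left.
  move=> k s1 km s1k F1 [[s1f none]|sol]; last first.
    apply: (@runs_if _ _ _ _ _ 1) => /= [s1f||].
    + by case: sol => c [T [[sf _] _ _ _]]; rewrite sf in s1f.
    + by move=> _; apply: runs_effectQ => //; right; apply: has_solution_eq sol.
    + by rewrite /center_cost; have : 0 < 2 ^ r; [rewrite expn_gt0|lia].
  have /card_gt0P[e0 _] : 0 < #|edge G| by apply: leq_ltn_trans km.
  set c0 := nth e0 (edge_list L) k.
  have c0k : edge_num L c0 = k by apply: num_ed.
  apply: (runs_weaken (runs_center (L := L) (z := z) (e0 := c0) (r := r)
    r0 card_r _ _ s1f _)) => //.
  + split; rewrite ?(frameN F1) ?(frameA F1) ?(frameRA F1) //.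
  + by rewrite c0k.
  + exact: edges_card (valP c0).
  + move=> s2 F2 [[s2f ok]|sol]; [left|right]; last first.
      by apply: has_solution_eq sol.
    split=> // c T; rewrite ltnS leq_eqVlt => /predU1P[ck|]; last exact: none.
    have -> : c = c0 by rewrite /c0 -ck ed_num.
    exact: ok.
- move=> s1 F1 H1; apply: (runs_finish (L := L) card_r).
  case: H1 => [[sf none]|sol]; [left|by right]; split=> // c T.
  exact: none (edge_num_lt L c).
- lia.
Qed.

(** * The operation count *)

(** The constant is not optimized.  Per center, filling the table costs at most
    a multiple of [r 2 ^ r m] because [r <= 2 ^ r]. *)
Lemma cost_bound m r : 0 < m -> 0 < r ->
  50 + m * (center_cost m r + 10) + 14 * r <=
  1000 * (m * (r * 2 ^ r * m + r ^ 2 * 2 ^ (r ^ 2)./2)).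
Proof.
move=> m0 r0; rewrite /center_cost.
have h0 : 0 < 2 ^ (r ^ 2)./2 by rewrite expn_gt0.
have p0 : 0 < 2 ^ r by rewrite expn_gt0.
have pr : r <= 2 ^ r by apply: ltnW; apply: ltn_expl.
set h := 2 ^ (r ^ 2)./2 in h0 *; set p := 2 ^ r in p0 pr *.
have a1 : p <= r * p * m by rewrite -mulnA mulnCA leq_pmulr // muln_gt0 r0.
have a2 : m * r ^ 2 <= r * p * m.
  by rewrite mulnC leq_mul2r expnS expn1 leq_mul2l pr !orbT.
have a3 : r <= r ^ 2 * h by rewrite expnS expn1 -mulnA leq_pmulr // muln_gt0 r0.
set x := r * p * m in a1 a2 *; set y := r ^ 2 * h in a3 *.
have -> : h * (720 * r ^ 2) = 720 * y by rewrite /y; lia.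
have y0 : 0 < y by apply: leq_trans a3.
have : 50 + 14 * r <= m * (64 * y).
  by apply: (@leq_trans (64 * y)); [lia|rewrite leq_pmull].
have : m * (127 * p + m * (200 * r ^ 2) + 720 * y + 10) <=
       m * (400 * x + 730 * y).
  by rewrite leq_mul2l; apply/orP; right; lia.
move: (m * (_ + 10)) => c b1 b2; lia.
Qed.

Theorem proposition1 (R : realType) :
  exists (p : prog) (C : R),
    forall (G : hypergraph) (r : nat) (z : node G + edge G -> R)
           (L : numbering G),
      (3 <= r)%N -> rank G = r -> no_isolated_node G ->
      (forall x, 0 <= z x <= 1)%R ->
      exists (s : state R) (k : nat),
        [/\ exec p (input L z) s k,
            correct_output L z s
          & (k%:R <= C * separation_bound R #|edges G| r)%R].
Proof.
exists main_prog, 1000%:R%R => G r z L r3 rankG _ _.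
have r0 : 0 < r by apply: leq_trans r3.
have card_r (e : edge G) : #|nodes_of e| <= r.
  by rewrite -rankG; apply: (leq_bigmax_cond _ (valP e)).
have m0 : 0 < #|edges G|.
  rewrite card_gt0; apply: contraTneq r3 => E.
  by rewrite -rankG /rank E big_set0.
have [s [k [E kc ok]]] := runs_main L z r0 card_r.
exists s, k; split=> //.
have mE : #|edge G| = #|edges G| by rewrite card_sig.
rewrite mE in kc; have {}kc := leq_trans kc (cost_bound m0 r0).
apply: (@le_trans _ _ (1000 * (#|edges G| *
  (r * 2 ^ r * #|edges G| + r ^ 2 * 2 ^ (r ^ 2)./2)))%:R%R).
  by rewrite ler_nat.
rewrite /separation_bound !(natrM, natrD, natrX) !ler_wpM2l //.
rewrite lerD2l ler_wpM2l ?exprn_ge0 ?ler0n //.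
(* Rounding the exponent down only decreases the power of two. *)
rewrite -[leLHS]powR_mulrn // ler_powR ?ler1n //.
rewrite ler_pdivlMr // -natrX -natrM ler_nat; lia.
Qed.
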